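(* Let $d\ge2$ and let $G=(X,E)$ be a finite, connected, $d$-regular combinatorial graph with vertex set $X$ satisfying $|X|\ge4d$ and edge set $E$. Let $Q(x,y)=\frac1d$ for $y\sim x$ (and $Q(x,y)=0$ otherwise) and $\pi(x)=1/|X|$ (simple random walk). Assume that the associated Markov chain $(X,Q,\pi)$ satisfies $CD_{ent}(0,\infty)$. Then $$d-\mu_2(G)\le\frac{4000\,d^4\log d}{\log(|X|/4)},$$ where $\mu_2(G)$ is the second largest eigenvalue of the adjacency matrix of $G$. In particular, for fixed $d$, $d-\mu_2(G_k)\to0$ for every family of finite connected $d$-regular graphs $G_k=(V_k,E_k)$ whose simple random walks satisfy $CD_{ent}(0,\infty)$ and for which $|V_k|\to\infty$; that is, there are no expanders of non-negative entropic curvature.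
   Context: $x\sim y$ means that $x$ and $y$ are adjacent. For $f,g\in\mathbb{R}^X$ put $\langle f,g\rangle_\pi=\sum_{x}f(x)g(x)\pi(x)$ and $\Delta f(x)=\sum_{y}(f(y)-f(x))Q(x,y)$. The logarithmic mean is $\theta_{log}(r,s)=\int_0^1r^{1-p}s^p\,dp$, and $\partial_1\theta_{log}(r,s)=\frac{\partial}{\partial r}\theta_{log}(r,s)$ for $r,s>0$. For $\rho\in(0,\infty)^X$ define $\Delta_\rho f(x)=\sum_{y}2\,\partial_1\theta_{log}(\rho(x),\rho(y))(f(y)-f(x))Q(x,y)$, $2\Gamma_\rho(f,g)=\Delta_\rho(fg)-f\Delta_\rho g-g\Delta_\rho f$, $2\Gamma_{2,\rho}(f,g)=\Delta\Gamma_\rho(f,g)-\Gamma_\rho(f,\Delta g)-\Gamma_\rho(g,\Delta f)$, and $\Gamma_{2,\rho}f=\Gamma_{2,\rho}(f,f)$. $(X,Q,\pi)$ satisfies $CD_{ent}(0,\infty)$ (non-negative entropic curvature) if $\langle\rho,\Gamma_{2,\rho}f\rangle_\pi\ge0$ for all $\rho\in(0,\infty)^X$ and all $f\in\mathbb{R}^X$. *)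

(* Defs.v *)
From HB Require Import structures.
From mathcomp Require Import all_boot all_order all_algebra.
From mathcomp Require Import complex.
From mathcomp Require Import spectral.
From mathcomp Require Import all_classical all_reals all_analysis.

Set Implicit Arguments.
Unset Strict Implicit.
Unset Printing Implicit Defensive.

Import Order.TTheory GRing.Theory Num.Theory numFieldNormedType.Exports.

Local Open Scope classical_set_scope.
Local Open Scope ring_scope.

(* Finite simple graphs are given by an adjacency relation [e] on a finite
   vertex type [X]. *)
Definition connected_regular_graph (X : finType) (e : rel X) (d : nat) : Prop :=
  [/\ symmetric e, irreflexive e,
      (forall x y, connect e x y)
    & (forall x, #|[set y | e x y]%SET| = d)].

(* The spectrum is only meaningful for matrices whose characteristic
   polynomial splits over [R], e.g. symmetric ones: see [eigenvalues_symP]. *)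
Section Eigenvalues.
Variables (R : realType) (n : nat).

Definition is_spectrum (A : 'M[R]_n) (s : seq R) : Prop :=
  sorted >=%R s /\ char_poly A = \prod_(a <- s) ('X - a%:P).

Definition eigenvalues (A : 'M[R]_n) : seq R :=
  xget [::] [set s | is_spectrum A s].

Lemma is_spectrum_inj (A : 'M[R]_n) (s t : seq R) :
  is_spectrum A s -> is_spectrum A t -> s = t.
Proof.
move=> [ss sE] [st tE].
have ge_tr : transitive (>=%R : rel R) by move=> y x z xy yz; apply: le_trans yz xy.
have ge_anti : antisymmetric (>=%R : rel R).
  by move=> x y; rewrite andbC => /le_anti.
apply: (sorted_eq ge_tr ge_anti ss st).
apply/allP => x _ /=; apply/eqP.
by rewrite -!mu_prod_XsubC -sE -tE.
Qed.

Lemma eigenvalues_symP (A : 'M[R]_n) :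
  A^T = A -> is_spectrum A (eigenvalues A).
Proof.
move=> symA; apply: (@xgetPex _ [::] [set s | is_spectrum A s]).
pose toC : {rmorphism R -> R[i]} := real_complex R.
pose B := map_mx toC A.
have hB : B \is hermsymmx.
  apply: realsym_hermsym.
    apply/is_hermitianmxP; rewrite expr0 scale1r map_mx_id //.
    by apply/matrixP => i j; rewrite !mxE -{1}symA mxE.
  apply/mxOverP => i j; rewrite mxE; apply/complex_realP.
  by exists (A i j).
have /mxOverP rB := hermitian_spectral_diag_real hB.
have /hermitian_normalmx/orthomx_spectralP eB := hB.
set D := spectral_diag B in rB eB; set P := spectralmx B in eB.
have uP : P \in unitmx by exact: spectral_unit.
pose s := [seq complex.Re (D 0 i) | i <- enum 'I_n].
have sE : char_poly A = \prod_(a <- s) ('X - a%:P).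
  apply: (map_poly_inj toC).
  rewrite map_char_poly -/B rmorph_prod /= big_map.
  have -> : char_poly B = char_poly (diag_mx D).
    rewrite eB /char_poly.
    have -> : char_poly_mx (invmx P *m diag_mx D *m P) =
        map_mx polyC (invmx P) *m char_poly_mx (diag_mx D) *m map_mx polyC P.
      rewrite /char_poly_mx !map_mxM mulmxBr mulmxBl; congr (_ - _).
      by rewrite mul_mx_scalar -scalemxAl -map_mxM mulVmx // map_mx1 scalemx1.
    rewrite !det_mulmx mulrAC -det_mulmx -map_mxM mulVmx //.
    by rewrite map_mx1 det1 mul1r.
  rewrite char_poly_trig ?diag_mx_is_trig // big_enum /=; apply: eq_bigr => i _.
  rewrite mxE eqxx mulr1n rmorphB /= map_polyX map_polyC /=.
  by congr (_ - _%:P); apply/esym; apply: RRe_real; apply: rB.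
exists (sort >=%R s); split.
  by apply: sort_sorted => x y; rewrite orbC; apply: le_total.
by rewrite sE; apply: perm_big; rewrite perm_sym perm_sort.
Qed.

End Eigenvalues.

Section SecondEigenvalue.
Variables (R : realType) (X : finType).

Definition adjacency_mx (e : rel X) : 'M[R]_#|X| :=
  \matrix_(i, j) (e (enum_val i) (enum_val j))%:R.

(* Eigenvalues are counted with multiplicity. *)
Definition mu2 (e : rel X) : R := nth 0 (eigenvalues (adjacency_mx e)) 1.

Lemma adjacency_spectrumP (e : rel X) :
  symmetric e -> is_spectrum (adjacency_mx e) (eigenvalues (adjacency_mx e)).
Proof.
by move=> syme; apply: eigenvalues_symP; apply/matrixP => i j; rewrite !mxE syme.
Qed.

End SecondEigenvalue.

Section LogarithmicMean.
Variable R : realType.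

Definition theta_log (r s : R) : R :=
  \int[lebesgue_measure]_(p in `[0, 1]) (r `^ (1 - p) * s `^ p).

Definition d1_theta_log (r s : R) : R :=
  derive1 (fun u : R => theta_log u s) r.

End LogarithmicMean.

Section EntropicCurvature.
Variables (R : realType) (X : finType) (Q : X -> X -> R) (pi : X -> R).
Implicit Types f g rho : X -> R.

Definition inner_pi f g : R := \sum_x f x * g x * pi x.

Definition laplacian f : X -> R := fun x => \sum_y (f y - f x) * Q x y.

Definition laplacian_rho rho f : X -> R := fun x =>
  \sum_y 2 * d1_theta_log (rho x) (rho y) * (f y - f x) * Q x y.

Definition Gamma_rho rho f g : X -> R := fun x =>
  2^-1 * (laplacian_rho rho (fun z => f z * g z) x
          - f x * laplacian_rho rho g x - g x * laplacian_rho rho f x).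

Definition Gamma2_rho rho f g : X -> R := fun x =>
  2^-1 * (laplacian (Gamma_rho rho f g) x
          - Gamma_rho rho f (laplacian g) x - Gamma_rho rho g (laplacian f) x).

Definition CDent_nonneg : Prop :=
  forall rho f, (forall x, 0 < rho x) -> 0 <= inner_pi rho (Gamma2_rho rho f f).

End EntropicCurvature.

Definition srw_kernel (R : realType) (X : finType) (e : rel X) (d : nat)
  (x y : X) : R := if e x y then d%:R^-1 else 0.

Definition srw_measure (R : realType) (X : finType) (x : X) : R := #|X|%:R^-1.

(* Main.v *)
Require Import Defs.
From mathcomp Require Import all_boot all_order all_algebra.
From mathcomp Require Import complex spectral.
From mathcomp Require Import all_classical all_reals all_analysis.
From mathcomp Require Import ring lra.

Set Implicit Arguments.
Unset Strict Implicit.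
Unset Printing Implicit Defensive.

Import Order.TTheory GRing.Theory Num.Theory numFieldNormedType.Exports.

Local Open Scope classical_set_scope.
Local Open Scope ring_scope.

(** Write [n] for the number of vertices, [P t] for the heat kernel of the walk
    and [lam = 1 - mu2 / d] for its spectral gap.  Let [H t] be the entropy of
    [P t x], averaged over the starting point [x].  Non-negative curvature
    makes [H] grow at most like [sqrt t], whereas a spectral gap makes it reach
    nearly the maximal value [ln n] by time [T = ln n / (2 lam)].  Comparing
    the two at time [T] bounds [lam] by a multiple of [d ^ 2 / ln n].

    Upper bound on the entropy.  The action [action rho f] is, up to a factor,
    the quantity [<rho, Gamma_rho f>]; along a heat flow run forwards in [rho]
    and backwards in [f] its derivative is [<rho, Gamma_2_rho f>] up to a
    factor, so it increases under the curvature condition.  As the logarithmic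
    mean lies below the arithmetic mean, the action is dominated by the
    derivative of [<rho_s, f_s ^ 2>]; integrating gives the reverse Poincare
    inequality [reverse_poincare].  Concentrating [rho] on the two ends of an
    edge turns it into a pointwise gradient bound ([heat_gradient]), which by
    duality says that the triangular discrimination
    [sum_z (p - q) ^ 2 / (p + q)] of [p = P t x] and [q = P t y], for [x ~ y],
    is at most [d / (2 t)] ([triangular_le]).

    The entropy production is an average over the edges of the Jeffreys
    divergences [sum_z (p - q) (ln p - ln q)], which the triangular
    discrimination controls once [sum_z p ^ 2 / q] is bounded.  The latter
    follows from a Harnack inequality ([heat_kernel_harnack]): after [k] jumps
    from [x], prepending the jump from [y] to [x] costs a factor [d], and the
    Poisson weights of [k] and [k + 1] jumps have the ratio [(k + 1) / t], whose
    mean is [1 + 1 / t].  Balancing the two bounds makes the Jeffreys divergence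
    at most [8 d / sqrt t], hence [entropy_le].

    Lower bound on the entropy.  Functions with mean zero have Rayleigh quotient
    at most [mu2] ([rayleigh_second_eigenvalue]), so that
    [sum_z P t x z ^ 2 <= 1 / n + exp (- 2 lam t)], which is [2 / n] at
    time [T]; by Jensen's inequality the entropy is then at least [ln (n / 2)]
    ([entropy_ge]). *)

(** * Derivatives and monotonicity of real functions *)

Section Calculus.
Variable R : realType.
Implicit Types (f g : R -> R) (x t : R).

Lemma is_derive_sumf (I : finType) (F : I -> R -> R) (dF : I -> R) x :
  (forall i, is_derive x 1 (F i) (dF i)) ->
  is_derive x 1 (fun t => \sum_i F i t) (\sum_i dF i).
Proof.
move=> dFi.
elim: (index_enum I) => [|i s IH].
  rewrite big_nil (_ : (fun _ => _) = cst 0); first exact: is_derive_cst.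
  by apply/funext => t; rewrite big_nil.
rewrite big_cons (_ : (fun _ => _) = F i + (fun t => \sum_(j <- s) F j t)).
  by apply: is_deriveD.
by apply/funext => t; rewrite big_cons.
Qed.

Lemma continuous_sumf (I : finType) (F : I -> R -> R) (x : R) :
  (forall i, {for x, continuous (F i)}) ->
  {for x, continuous (fun t => \sum_i F i t)}.
Proof.
move=> cF; elim: (index_enum I) => [|i s IH].
  rewrite (_ : (fun _ => _) = cst 0); first exact: cvg_cst.
  by apply/funext => t; rewrite big_nil.
rewrite (_ : (fun _ => _) = fun t => F i t + (\sum_(j <- s) F j t)).
  by apply: cvgD; [exact: cF | exact: IH].
by apply/funext => t; rewrite big_cons.
Qed.

Lemma is_derive_mul f g x a b : is_derive x 1 f a -> is_derive x 1 g b ->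
  is_derive x 1 (fun t => f t * g t) (a * g x + f x * b).
Proof.
move=> df dg; have := is_deriveM df dg.
by move=> H; apply: is_derive_eq H _; rewrite addrC /GRing.scale /= mulrC (mulrC a).
Qed.

Lemma is_derive_mulC f x a c : is_derive x 1 f a ->
  is_derive x 1 (fun t => f t * c) (a * c).
Proof.
move=> df; have := is_derive_mul df (is_derive_cst c x 1).
by move=> H; apply: is_derive_eq H _; rewrite mulr0 addr0.
Qed.

Lemma is_derive_compf f g x a b : is_derive (g x) 1 f a ->
  is_derive x 1 g b -> is_derive x 1 (fun t => f (g t)) (a * b).
Proof. exact: is_derive1_comp. Qed.

Lemma is_derive_continuous f x a : is_derive x 1 f a -> {for x, continuous f}.
Proof.
by move=> [df _]; apply: differentiable_continuous; apply/derivable1_diffP.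
Qed.

Lemma le_of_ge0_derive_oo f f' a b : a <= b ->
  (forall x, a <= x <= b -> {for x, continuous f}) ->
  (forall x, a < x < b -> is_derive x 1 f (f' x)) ->
  (forall x, a < x < b -> 0 <= f' x) -> f a <= f b.
Proof.
move=> ab cf df f'0; apply: (@ger0_derive1_le_cc _ f a b) => //.
- by move=> x /[!in_itv]/= /df [].
- move=> x /[!in_itv]/= axb; rewrite derive1E.
  by rewrite (@derive_val _ _ _ _ _ _ _ (df x axb)) f'0.
- apply/continuous_in_subspaceT => x; rewrite inE /= in_itv /=; exact: cf.
- by rewrite in_itv /= lexx ab.
- by rewrite in_itv /= lexx ab.
Qed.

Lemma le_of_ge0_derive f f' a b : a <= b ->
  (forall x, a <= x <= b -> is_derive x 1 f (f' x)) ->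
  (forall x, a < x < b -> 0 <= f' x) -> f a <= f b.
Proof.
move=> ab df; apply: le_of_ge0_derive_oo => // x.
  by move=> /df /is_derive_continuous.
by move=> /andP[ax xb]; apply: df; rewrite !ltW.
Qed.

End Calculus.

(** * Exponential generating functions of bounded sequences *)

Section Egf.
Variable R : realType.
Implicit Types (b c : nat -> R) (x t : R).

(** Both the heat kernel, [b k] being a [k]-step transition probability, and
    the function [(exp v - 1) / v] have this form. *)
Definition egf b t : R := limn (pseries (fun k => b k / k`!%:R) t).

Definition bounded_coefs b := exists M, forall k, `|b k| <= M.

Lemma bounded_coefs01 b : (forall k, 0 <= b k <= 1) -> bounded_coefs b.
Proof. by move=> b01; exists 1 => k; have /andP[? ?] := b01 k; rewrite ger0_norm. Qed.

Lemma bounded_coefs_cst1 : bounded_coefs (fun=> 1).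
Proof. by apply: bounded_coefs01 => k; rewrite ler01 lexx. Qed.

Lemma bounded_coefs_delta0 : bounded_coefs (fun k => (k == 0%N)%:R).
Proof. by apply: bounded_coefs01 => k; rewrite ler0n lern1 leq_b1. Qed.

Lemma cvg_egf b t : bounded_coefs b ->
  cvgn (pseries (fun k => b k / k`!%:R) t).
Proof.
move=> [M bM]; apply: normed_cvg.
apply: (@series_le_cvg _ _ (fun k => M * exp_coeff `|t| k)) => [k|k|k|].
- exact: normr_ge0.
- by rewrite mulr_ge0 ?exp_coeff_ge0 // (le_trans _ (bM 0%N)).
- rewrite /exp_coeff /= normrM normrX normrM normfV normr_nat.
  by rewrite -mulrA [X in _ <= M * X]mulrC ler_wpM2r ?bM // mulr_ge0 ?invr_ge0 ?exprn_ge0.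
- have := @is_cvg_seriesZ _ (exp_coeff `|t|) M (is_cvg_series_exp_coeff _).
  by [].
Qed.

Lemma bounded_shift b : bounded_coefs b -> bounded_coefs (fun k => b k.+1).
Proof. by move=> [M bM]; exists M. Qed.

Lemma pseries_diffs_egf b :
  pseries_diffs (fun k => b k / k`!%:R) = (fun k => b k.+1 / k`!%:R).
Proof.
apply/funext => k; rewrite /pseries_diffs factS natrM invfM.
by rewrite mulrCA mulVKf.
Qed.

(** Differentiating an exponential generating function shifts its
    coefficients; boundedness makes the radius of convergence infinite. *)
Lemma is_derive_egf b t : bounded_coefs b ->
  is_derive t 1 (egf b) (egf (fun k => b k.+1) t).
Proof.
move=> hb; have h1 := bounded_shift hb; have h2 := bounded_shift h1.
rewrite /egf -pseries_diffs_egf.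
apply: (@pseries_snd_diffs _ _ (`|t| + 1)).
- exact: cvg_egf.
- by rewrite pseries_diffs_egf; apply: cvg_egf.
- by rewrite !pseries_diffs_egf; apply: cvg_egf.
- by rewrite [ltRHS]ger0_norm// addrC -subr_gt0 addrK.
Qed.

Lemma egf_cst1 t : egf (fun=> 1) t = expR t.
Proof.
rewrite expRE /egf; congr (limn (pseries _ t)).
by apply/funext => k; rewrite mul1r.
Qed.

Lemma egf_at0 b : egf b 0 = b 0%N.
Proof.
rewrite /egf; apply/cvg_lim => //; rewrite -(cvg_shiftS _).
rewrite (_ : (fun _ => _) = cst (b 0%N)); first exact: cvg_cst.
apply/funext => k; rewrite /pseries /series /= big_nat_recl //= fact0 divr1.
by rewrite expr0 mulr1 big1 ?addr0 // => i _; rewrite expr0n /= mulr0.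
Qed.

Lemma egf_delta0 t : egf (fun k => (k == 0%N)%:R) t = 1.
Proof.
rewrite /egf; apply/cvg_lim => //; rewrite -(cvg_shiftS _).
rewrite (_ : (fun _ => _) = cst 1); first exact: cvg_cst.
apply/funext => k; rewrite /pseries /series /= big_nat_recl //= fact0 divr1.
by rewrite expr0 mulr1 big1 ?addr0 // => i _; rewrite !mul0r.
Qed.

Lemma bounded_coefsD b c : bounded_coefs b -> bounded_coefs c ->
  bounded_coefs (fun k => b k + c k).
Proof.
move=> [M hM] [N hN]; exists (M + N) => k.
by rewrite (le_trans (ler_normD _ _))// lerD.
Qed.

Lemma bounded_coefsZ a b : bounded_coefs b -> bounded_coefs (fun k => a * b k).
Proof. by move=> [M hM]; exists (`|a| * M) => k; rewrite normrM ler_wpM2l. Qed.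

Lemma egfD b c t : bounded_coefs b -> bounded_coefs c ->
  egf (fun k => b k + c k) t = egf b t + egf c t.
Proof.
move=> hb hc; rewrite /egf -(lim_seriesD (@cvg_egf _ t hb) (@cvg_egf _ t hc)).
congr (limn (series _)); apply/funext => k /=.
by rewrite !fctE mulrDl mulrDl.
Qed.

Lemma egfZ a b t : bounded_coefs b ->
  egf (fun k => a * b k) t = a * egf b t.
Proof.
move=> hb; rewrite /egf -[RHS](lim_seriesZ a (@cvg_egf _ t hb)).
congr (limn (series _)); apply/funext => k /=.
by rewrite !fctE /GRing.scale /= !mulrA.
Qed.

Lemma egf_sum (I : finType) (b : I -> nat -> R) t :
  (forall i, bounded_coefs (b i)) ->
  egf (fun k => \sum_i b i k) t = \sum_i egf (b i) t.
Proof.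
move=> hb; suff [] : bounded_coefs (fun k => \sum_i b i k) /\
    egf (fun k => \sum_i b i k) t = \sum_i egf (b i) t by [].
elim: (index_enum I) => [|i s [IH1 IH2]].
  have e0 : (fun k => \sum_(i <- [::]) b i k) = (fun k => 0 * 1).
    by apply/funext => k; rewrite big_nil mul0r.
  have h1 := bounded_coefs_cst1.
  rewrite e0; split; first exact: bounded_coefsZ.
  by rewrite egfZ // mul0r big_nil.
have -> : (fun k => \sum_(j <- i :: s) b j k) =
    (fun k => b i k + \sum_(j <- s) b j k).
  by apply/funext => k; rewrite big_cons.
by split; [exact: bounded_coefsD | rewrite egfD // IH2 big_cons].
Qed.

Lemma egf_ge_partial b t n : bounded_coefs b -> (forall k, 0 <= b k) -> 0 <= t ->
  \sum_(0 <= k < n) b k / k`!%:R * t ^+ k <= egf b t.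
Proof.
move=> hb b0 t0; rewrite /egf.
apply: (@nondecreasing_cvgn_le _ (pseries (fun k => b k / k`!%:R) t)).
  apply: nondecreasing_series => k _ _.
  by rewrite mulr_ge0 ?divr_ge0 ?exprn_ge0.
exact: cvg_egf.
Qed.

Lemma egf_le_partial b t M : bounded_coefs b ->
  (forall n, \sum_(0 <= k < n) b k / k`!%:R * t ^+ k <= M) -> egf b t <= M.
Proof.
move=> hb h; apply: limr_le; first exact: cvg_egf.
by apply: nearW => n; apply: h.
Qed.

Lemma egf_le b c t : bounded_coefs b -> bounded_coefs c -> 0 <= t ->
  (forall k, b k <= c k) -> egf b t <= egf c t.
Proof.
move=> hb hc t0 bc; apply: lim_series_le.
- exact: cvg_egf.
- exact: cvg_egf.
- by move=> k /=; rewrite ler_wpM2r ?exprn_ge0 // ler_wpM2r.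
Qed.

End Egf.

(** * The logarithmic mean *)

Section LogMean.
Variable R : realType.
Implicit Types r s v t : R.

Definition exp_dq_coef (k : nat) : R := k.+1%:R^-1.

(** The difference quotient [(exp v - 1) / v] of the exponential between [0] and
    [v].  The series makes it smooth at [v = 0], where the quotient is
    singular. *)
Definition exp_dq v : R := egf exp_dq_coef v.

Definition exp_dq' v : R := egf (fun k => exp_dq_coef k.+1) v.

Lemma bounded_exp_dq_coef : bounded_coefs exp_dq_coef.
Proof.
by apply: bounded_coefs01 => k; rewrite invr_ge0 ler0n invf_le1 ?ler1n.
Qed.

Lemma is_derive_exp_dq v : is_derive v 1 exp_dq (exp_dq' v).
Proof. exact: is_derive_egf bounded_exp_dq_coef. Qed.

Lemma exp_dqE v : v * exp_dq v = expR v - 1.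
Proof.
pose c (k : nat) : R := (k != 0%N)%:R.
have hc : bounded_coefs c.
  by apply: bounded_coefs01 => k; rewrite ler0n lern1 leq_b1.
have h1 := @bounded_coefs_cst1 R; have h0 := @bounded_coefs_delta0 R.
have ec : egf c v = expR v - 1.
  have -> : c = (fun k => 1 + (-1) * (k == 0%N)%:R).
    by apply/funext => k; rewrite /c; case: eqP => _ /=; ring.
  by rewrite egfD ?egfZ ?egf_cst1 ?egf_delta0 ?mulN1r //; exact: bounded_coefsZ.
have l1 : pseries (fun k => c k / k`!%:R) v n.+1 @[n --> \oo] --> v * exp_dq v.
  have -> : (fun n => pseries (fun k => c k / k`!%:R) v n.+1) =
      (fun n => v * pseries (fun k => exp_dq_coef k / k`!%:R) v n).
    apply/funext => n; rewrite /pseries /series /= big_nat_recl //=.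
    rewrite /c !mul0r add0r mulr_sumr; apply: eq_bigr => i _ /=.
    rewrite factS natrM exprS /exp_dq_coef invfM; ring.
  apply: cvgMr; exact: cvg_egf bounded_exp_dq_coef.
have l2 : pseries (fun k => c k / k`!%:R) v n.+1 @[n --> \oo] --> egf c v.
  by rewrite cvg_shiftS; apply: cvg_egf.
by rewrite -ec -(cvg_lim _ l1) // (cvg_lim _ l2).
Qed.

Lemma exp_dq0 : exp_dq 0 = 1.
Proof. by rewrite /exp_dq egf_at0 /exp_dq_coef invr1. Qed.

Lemma exp_dq_deriveE v : exp_dq v + v * exp_dq' v = expR v.
Proof.
have d1 : is_derive v 1 (fun t => t * exp_dq t) (1 * exp_dq v + v * exp_dq' v).
  by apply: is_derive_mul; apply: is_derive_exp_dq.
have d2 : is_derive v 1 (fun t => t * exp_dq t) (expR v).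
  have -> : (fun t => t * exp_dq t) = expR - cst 1.
    by apply/funext => t; rewrite exp_dqE.
  have := is_deriveB (is_derive_expR v) (is_derive_cst (1 : R) v 1).
  by rewrite subr0.
by rewrite -(@derive_val _ _ _ _ _ _ _ d2) (@derive_val _ _ _ _ _ _ _ d1) mul1r.
Qed.

(** This identity encodes the symmetry of the logarithmic mean, and the
    next one the symmetry of its partial derivatives. *)
Lemma exp_dqN v : exp_dq (- v) = expR (- v) * exp_dq v.
Proof.
have [->|v0] := eqVneq v 0; first by rewrite oppr0 exp_dq0 expR0 mulr1.
apply: (mulfI v0); rewrite mulrCA exp_dqE mulrBr -expRD addNr expR0 mulr1.
by have := exp_dqE (- v); rewrite mulNr => /(congr1 -%R); rewrite opprK => ->; rewrite opprB.
Qed.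

Lemma exp_dq'N v : exp_dq (- v) - exp_dq' (- v) = expR (- v) * exp_dq' v.
Proof.
have d1 : is_derive v 1 (fun t => exp_dq (- t)) (-1 * exp_dq' (- v)).
  by have := @is_derive1_comp _ exp_dq -%R v _ _ (is_derive_exp_dq (- v)) (is_deriveNid v 1);
     rewrite mulrC.
have d2 : is_derive v 1 (fun t => exp_dq (- t)) (- expR (- v) * exp_dq v + expR (- v) * exp_dq' v).
  have -> : (fun t => exp_dq (- t)) = (fun t => expR (- t) * exp_dq t).
    by apply/funext => t; rewrite exp_dqN.
  apply: is_derive_mul; last exact: is_derive_exp_dq.
  have := @is_derive1_comp _ expR -%R v _ _ (is_derive_expR (- v)) (is_deriveNid v 1).
  by rewrite mulrN1.
have := @derive_val _ _ _ _ _ _ _ d2; rewrite (@derive_val _ _ _ _ _ _ _ d1) exp_dqN.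
by move=> ?; lra.
Qed.

Lemma exp_dq_ge0 v : 0 <= exp_dq v.
Proof.
have [->|v0] := eqVneq v 0; first by rewrite exp_dq0.
have := exp_dqE v; have [vp|vn] := ltP 0 v => e.
  rewrite -(pmulr_rge0 _ vp) e subr_ge0 -expR0 ler_expR; exact: ltW.
rewrite -(nmulr_rle0 (exp_dq v) (_ : v < 0)) ?lt_neqAle ?v0 //.
by rewrite e subr_le0 -expR0 ler_expR.
Qed.

(** For [v >= 0] the comparison holds coefficientwise, as
    [1 / (k + 1) <= 1 / 2] for [k >= 1] and there is equality for [k = 0]; the
    identity [exp_dqN] carries it over to [v < 0]. *)
Lemma exp_dq_le v : exp_dq v <= (1 + expR v) / 2.
Proof.
wlog v0 : v / 0 <= v.
  move=> h; have [|vn] := leP 0 v; first exact: h.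
  have := h (- v); rewrite exp_dqN oppr_ge0 (ltW vn) => /(_ isT).
  have e0 := expR_gt0 v.
  move=> /(ler_wpM2l (ltW e0)); rewrite mulrA mulrA mulrDr -expRD addrN expR0 mul1r mulr1.
  by rewrite addrC.
have h1 := @bounded_coefs_cst1 R; have h0 := @bounded_coefs_delta0 R.
have -> : (1 + expR v) / 2 = egf (fun k => 2^-1 * (k == 0%N)%:R + 2^-1 * 1) v.
  by rewrite egfD ?egfZ ?egf_delta0 ?egf_cst1 //; [field | exact: bounded_coefsZ ..].
apply: egf_le => //; first exact: bounded_exp_dq_coef.
  by apply: bounded_coefsD; apply: bounded_coefsZ.
case=> [|k]; rewrite /exp_dq_coef /=; first by rewrite invr1; lra.
rewrite mulr0 add0r mulr1 lef_pV2 ?posrE //.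
by rewrite (_ : 2 = 2%:R :> R) // ler_nat.
Qed.

End LogMean.

Section Theta.
Variable R : realType.
Implicit Types r s t : R.

(** The integrand is [r * exp (p * v)] with [v = ln s - ln r], whose primitive
    [r * p * exp_dq (p * v)] needs no case distinction at [v = 0]. *)
Lemma theta_logE r s : 0 < r -> 0 < s -> theta_log r s = r * exp_dq (ln s - ln r).
Proof.
move=> r0 s0; set v := ln s - ln r.
pose F (p : R) := r * (p * exp_dq (p * v)).
have dF (p : R) : is_derive p (1 : R) F (r * expR (p * v)).
  have dl : is_derive p (1:R) (fun p => exp_dq (p * v)) (v * exp_dq' (p * v)).
    have dv : is_derive p (1:R) (fun p => p * v) (1 * v) by apply: is_derive_mulC.
    have := @is_derive_compf _ (@exp_dq R) (fun p => p * v) p _ _ (is_derive_exp_dq (p * v)) dv.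
    by rewrite mul1r mulrC.
  have := is_derive_mulC r (is_derive_mul (is_derive_id p (1:R)) dl).
  rewrite (_ : (fun t => _) = F); last by apply/funext => t; rewrite /F mulrC.
  by move=> H; apply: is_derive_eq H _; rewrite mul1r mulrA exp_dq_deriveE mulrC.
have cF : continuous F.
  by move=> p; apply: is_derive_continuous (dF p).
have cf : continuous (fun p : R => r * expR (p * v)).
  move=> p; apply: cvgMr; apply: continuous_comp; last exact: continuous_expR.
  by apply: cvgMl; apply: cvg_id.
have := @continuous_FTC2 R (fun p => r * expR (p * v)) F 0 1 ltr01.
have -> : F 0 = 0 by rewrite /F mul0r mulr0.
have -> : F 1 = r * exp_dq v by rewrite /F !mul1r.
move=> ftc.
have integrandE (p : R) : r `^ (1 - p) * s `^ p = r * expR (p * v).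
  rewrite /powR !gt_eqF // -expRD (_ : _ + _ = ln r + p * v); last first.
    by rewrite /v; ring.
  by rewrite expRD lnK.
rewrite /theta_log /Rintegral.
under eq_integral do rewrite integrandE.
rewrite ftc ?sube0 //.
- by apply: continuous_subspaceT.
- split.
  + by move=> x _; have [] := dF x.
  + by apply: cvg_at_right_filter; apply: cF.
  + by apply: cvg_at_left_filter; apply: cF.
- by move=> x _; rewrite derive1E; exact: (@derive_val _ _ _ _ _ _ _ (dF x)).
Qed.

Lemma theta_log_ge0 r s : 0 < r -> 0 < s -> 0 <= theta_log r s.
Proof. by move=> r0 s0; rewrite theta_logE // mulr_ge0 ?exp_dq_ge0 // ltW. Qed.

Lemma theta_log_diag r : 0 < r -> theta_log r r = r.
Proof. by move=> r0; rewrite theta_logE // subrr exp_dq0 mulr1. Qed.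

Lemma theta_log_le_mean r s : 0 < r -> 0 < s -> theta_log r s <= (r + s) / 2.
Proof.
move=> r0 s0; rewrite theta_logE //.
apply: le_trans (ler_wpM2l (ltW r0) (exp_dq_le _)) _.
rewrite expRB !lnK ?posrE // mulrA mulrDr mulr1 mulrCA divff ?gt_eqF // mulr1.
by [].
Qed.

(** In the form [r * exp_dq (ln s - ln r)] the mean depends on a curve through
    functions of one real variable only. *)
Lemma is_derive_theta_curve (r s : R -> R) (x r' s' : R) :
  is_derive x 1 r r' -> is_derive x 1 s s' -> 0 < r x -> 0 < s x ->
  let v := ln (s x) - ln (r x) in
  is_derive x 1 (fun t => theta_log (r t) (s t))
    ((exp_dq v - exp_dq' v) * r' + r x / s x * exp_dq' v * s').
Proof.
move=> dr ds r0 s0 v.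
apply: (@near_eq_is_derive _ _ _ (fun t => r t * exp_dq (ln (s t) - ln (r t)))).
  have nr : \forall t \near x, 0 < r t.
    exact: (cvgr_gt (r x) (is_derive_continuous dr) 0 r0).
  have ns : \forall t \near x, 0 < s t.
    exact: (cvgr_gt (s x) (is_derive_continuous ds) 0 s0).
  by near=> t; rewrite theta_logE //; near: t.
have dlr := is_derive_compf (is_derive1_ln r0) dr.
have dls := is_derive_compf (is_derive1_ln s0) ds.
have dv : is_derive x 1 (fun t => ln (s t) - ln (r t))
    ((s x)^-1 * s' - (r x)^-1 * r') by exact: is_deriveB.
have dl := @is_derive_compf _ (@exp_dq R) (fun t => ln (s t) - ln (r t)) x _ _
  (is_derive_exp_dq v) dv.
have := is_derive_mul dr dl.
move=> H; apply: is_derive_eq H _.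
rewrite -/v; field.
by rewrite !gt_eqF.
Unshelve. all: by end_near. Qed.

Lemma d1_theta_logE r s : 0 < r -> 0 < s ->
  d1_theta_log r s = exp_dq (ln s - ln r) - exp_dq' (ln s - ln r).
Proof.
move=> r0 s0.
have := is_derive_theta_curve (is_derive_id r 1) (is_derive_cst s r 1) r0 s0.
rewrite /= mulr1 mulr0 addr0 /d1_theta_log derive1E => d.
exact: (@derive_val _ _ _ _ _ _ _ d).
Qed.

Lemma d1_theta_logC r s : 0 < r -> 0 < s ->
  d1_theta_log s r = r / s * exp_dq' (ln s - ln r).
Proof.
move=> r0 s0; rewrite d1_theta_logE // -[ln r - ln s]opprB exp_dq'N opprB expRB.
by rewrite !lnK.
Qed.

(** Euler's identity for a 1-homogeneous function, which turns the
    unsymmetric [Gamma_rho] into the symmetric action. *)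
Lemma theta_log_Euler r s : 0 < r -> 0 < s ->
  r * d1_theta_log r s + s * d1_theta_log s r = theta_log r s.
Proof.
move=> r0 s0; rewrite (@d1_theta_logC r s) // d1_theta_logE // theta_logE //.
by field; rewrite gt_eqF.
Qed.

Lemma is_derive_theta (r s : R -> R) (x r' s' : R) :
  is_derive x 1 r r' -> is_derive x 1 s s' -> 0 < r x -> 0 < s x ->
  is_derive x 1 (fun t => theta_log (r t) (s t))
    (d1_theta_log (r x) (s x) * r' + d1_theta_log (s x) (r x) * s').
Proof.
move=> dr ds r0 s0; rewrite (@d1_theta_logC (r x) (s x)) // d1_theta_logE //.
exact: is_derive_theta_curve.
Qed.

End Theta.

(** * The action and the reverse Poincare inequality *)

Section Curvature.
Variables (R : realType) (X : finType) (Q : X -> X -> R).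
Hypothesis Qsym : forall x y, Q x y = Q y x.
Hypothesis Q0 : forall x y, 0 <= Q x y.
Implicit Types f g rho : X -> R.

Lemma sum_swap (F : X -> X -> R) : \sum_x \sum_y F y x = \sum_x \sum_y F x y.
Proof. by rewrite exchange_big. Qed.

Lemma sum_laplacian_adj f g :
  \sum_x f x * laplacian Q g x = \sum_x laplacian Q f x * g x.
Proof.
have E (u v : X -> R) : \sum_x u x * laplacian Q v x =
    \sum_x \sum_y u x * v y * Q x y - \sum_x \sum_y u x * v x * Q x y.
  rewrite -sumrB; apply: eq_bigr => x _; rewrite mulr_sumr -sumrB.
  by apply: eq_bigr => y _; ring.
rewrite E; under [RHS]eq_bigr do rewrite mulrC.
rewrite E -(sum_swap (fun x y => g x * f y * Q x y)); congr (_ - _).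
  by apply: eq_bigr => x _; apply: eq_bigr => y _; rewrite Qsym; ring.
by apply: eq_bigr => x _; apply: eq_bigr => y _; ring.
Qed.

Lemma Gamma_rhoE rho f g x : Gamma_rho Q rho f g x =
  \sum_y d1_theta_log (rho x) (rho y) * (f y - f x) * (g y - g x) * Q x y.
Proof.
rewrite /Gamma_rho /laplacian_rho !mulr_sumr -!sumrB mulr_sumr.
by apply: eq_bigr => y _; field.
Qed.

(** Twice the sum of [rho * Gamma_rho f], by Euler's identity and the symmetry
    of [Q]. *)
Definition action rho f : R :=
  \sum_x \sum_y theta_log (rho x) (rho y) * (f x - f y) ^+ 2 * Q x y.

(** The derivative of the action when [rho] follows the heat equation and [f]
    the backward heat equation. *)
Definition action_rate rho f : R := \sum_x \sum_y
  ((d1_theta_log (rho x) (rho y) * laplacian Q rho x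
    + d1_theta_log (rho y) (rho x) * laplacian Q rho y) * (f x - f y) ^+ 2 * Q x y
   - 2 * theta_log (rho x) (rho y) * (f x - f y)
     * (laplacian Q f x - laplacian Q f y) * Q x y).

(** This is where [Gamma_2] comes from.  Both sides are expanded over the edges;
    the symmetry of [Q] moves the Laplacian from [Gamma_rho] to [rho], and
    Euler's identity matches the terms with [laplacian f]. *)
Lemma action_rateE rho f : (forall x, 0 < rho x) ->
  action_rate rho f =
  4 * (#|X|%:R * inner_pi (@srw_measure R X) rho (Gamma2_rho Q rho f f)).
Proof.
move=> rho0; have [x0|noX] := pickP (pred_of_simpl (@predT X)); last first.
  by rewrite /action_rate /inner_pi !big_pred0 ?mulr0 // => x; have := noX x.
move=> _; have n0 : (#|X|%:R : R) != 0.
  by rewrite pnatr_eq0 -lt0n; apply/card_gt0P; exists x0.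
have -> : #|X|%:R * inner_pi (@srw_measure R X) rho (Gamma2_rho Q rho f f) =
    2^-1 * (\sum_x laplacian Q rho x * Gamma_rho Q rho f f x)
    - \sum_x rho x * Gamma_rho Q rho f (laplacian Q f) x.
  rewrite -(sum_laplacian_adj rho (Gamma_rho Q rho f f)).
  rewrite [2^-1 * _]mulr_sumr -sumrB /inner_pi mulr_sumr.
  apply: eq_bigr => x _; rewrite /srw_measure /Gamma2_rho; field.
  exact: n0.
rewrite mulrBr mulrA (_ : 4 * 2^-1 = 2); last by field.
rewrite /action_rate.
under eq_bigr do rewrite sumrB.
rewrite sumrB; congr (_ - _).
  pose F x y := d1_theta_log (rho x) (rho y) * laplacian Q rho x *
    (f x - f y) ^+ 2 * Q x y.
  transitivity (\sum_x \sum_y F x y + \sum_x \sum_y F y x).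
    rewrite -big_split; apply: eq_bigr => x _; rewrite -big_split /=.
    apply: eq_bigr => y _; rewrite /F (Qsym y x).
    move: (d1_theta_log (rho x) (rho y)) (d1_theta_log (rho y) (rho x)) => a b.
    by move: (laplacian Q rho x) (laplacian Q rho y) => u v; ring.
  rewrite (sum_swap F) -[LHS]mulr2n -[LHS]mulr_natl; congr (_ * _).
  apply: eq_bigr => x _; rewrite Gamma_rhoE mulr_sumr.
  apply: eq_bigr => y _; rewrite /F.
  by move: (d1_theta_log _ _) (laplacian _ _ _) => a u; ring.
pose F x y := rho x * d1_theta_log (rho x) (rho y) * 2 * (f x - f y) *
    (laplacian Q f x - laplacian Q f y) * Q x y.
transitivity (\sum_x \sum_y F x y + \sum_x \sum_y F y x).
  rewrite -big_split; apply: eq_bigr => x _; rewrite -big_split /=.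
  apply: eq_bigr => y _; rewrite /F (Qsym y x) -theta_log_Euler //.
  move: (d1_theta_log (rho x) (rho y)) (d1_theta_log (rho y) (rho x)) => a b.
  by move: (laplacian Q f x) (laplacian Q f y) => u v; ring.
rewrite (sum_swap F) -[LHS]mulr2n -[LHS]mulr_natl (_ : 4 = 2 * 2); last by ring.
rewrite -mulrA; congr (_ * _); rewrite mulr_sumr.
apply: eq_bigr => x _; rewrite Gamma_rhoE !mulr_sumr.
apply: eq_bigr => y _; rewrite /F.
move: (d1_theta_log _ _) (laplacian Q f x) (laplacian Q f y) => a u v.
by ring.
Qed.

Section HeatFlow.
Variables (rho g : R -> X -> R) (t : R).
Hypothesis t0 : 0 <= t.
Hypothesis rho0 : forall s x, 0 <= s <= t -> 0 < rho s x.
Hypothesis drho : forall s x, 0 <= s <= t ->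
  is_derive s 1 (rho ^~ x) (laplacian Q (rho s) x).
Hypothesis dg : forall s x, 0 <= s <= t ->
  is_derive s 1 (g ^~ x) (- laplacian Q (g s) x).
Hypothesis CD : CDent_nonneg Q (@srw_measure R X).

Lemma is_derive_action s : 0 <= s <= t ->
  is_derive s 1 (fun u => action (rho u) (g u)) (action_rate (rho s) (g s)).
Proof.
move=> st; apply: is_derive_sumf => x; apply: is_derive_sumf => y.
have dd : is_derive s 1 (fun u => g u x - g u y)
    (- laplacian Q (g s) x - - laplacian Q (g s) y).
  by apply: is_deriveB; exact: dg.
have dth : is_derive s 1 (fun u => theta_log (rho u x) (rho u y)) _ :=
  is_derive_theta (drho x st) (drho y st) (rho0 x st) (rho0 y st).
have d := is_derive_mulC (Q x y) (is_derive_mul dth (is_derive_mul dd dd)).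
apply: is_derive_eq d _.
move: (d1_theta_log (rho s x) _) (d1_theta_log (rho s y) _) => a b.
move: (theta_log _ _) (laplacian Q (g s) x) (laplacian Q (g s) y) => c u v.
by ring.
Qed.

Lemma action_le s : 0 <= s <= t -> action (rho 0) (g 0) <= action (rho s) (g s).
Proof.
move=> /andP[s0 st].
apply: (@le_of_ge0_derive _ (fun u => action (rho u) (g u))
  (fun u => action_rate (rho u) (g u))) => //.
  by move=> u /andP[u0 us]; apply: is_derive_action; rewrite u0 (le_trans us).
move=> u /andP[u0 us].
have ut : 0 <= u <= t by rewrite (ltW u0) (le_trans (ltW us)).
have rhou x : 0 < rho u x by exact: rho0.
by rewrite action_rateE // mulr_ge0 // mulr_ge0 //; exact: CD.
Qed.

(** The logarithmic mean is below the arithmetic mean, and the action formed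
    with the latter is the energy weighted by [u]. *)
Lemma action_le_energy u f : (forall x, 0 < u x) ->
  action u f <= \sum_x \sum_y u x * (f y - f x) ^+ 2 * Q x y.
Proof.
move=> u0.
pose F x y := 2^-1 * u x * (f y - f x) ^+ 2 * Q x y.
have -> : \sum_x \sum_y u x * (f y - f x) ^+ 2 * Q x y =
    \sum_x \sum_y F x y + \sum_x \sum_y F y x.
  rewrite (sum_swap F) -[RHS]mulr2n -[RHS]mulr_natl mulr_sumr; apply: eq_bigr => x _.
  by rewrite mulr_sumr; apply: eq_bigr => y _; rewrite /F; field.
rewrite -big_split; apply: ler_sum => x _; rewrite -big_split; apply: ler_sum => y _.
rewrite /F (Qsym y x) /=.
have -> : 2^-1 * u x * (f y - f x) ^+ 2 * Q x y +
   2^-1 * u y * (f x - f y) ^+ 2 * Q x y =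
   (u x + u y) / 2 * (f x - f y) ^+ 2 * Q x y by field.
by rewrite !ler_wpM2r ?sqr_ge0 // theta_log_le_mean.
Qed.

(** The derivative of [sum rho_s * g_s ^ 2] is the energy of [g_s] weighted by
    [rho_s], which is at least the action at time [s], and so at least the
    action at time [0]. *)
Lemma reverse_poincare :
  t * action (rho 0) (g 0) <= \sum_x rho t x * g t x ^+ 2.
Proof.
set a := action _ _.
pose Psi s := \sum_x rho s x * g s x ^+ 2 - s * a.
suff : Psi 0 <= Psi t.
  rewrite /Psi mul0r subr0 => h.
  rewrite -subr_ge0; apply: le_trans h; apply: sumr_ge0 => x _.
  by rewrite mulr_ge0 ?sqr_ge0 // ltW // rho0 // lexx t0.
apply: (@le_of_ge0_derive _ Psi (fun s =>
  \sum_x \sum_y rho s x * (g s y - g s x) ^+ 2 * Q x y - a)) => //.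
- move=> s st; apply: is_deriveB; last first.
    by have := is_derive_mulC a (is_derive_id s (1:R)); rewrite mul1r.
  have dx x : is_derive s 1 (fun u => rho u x * g u x ^+ 2)
      (laplacian Q (rho s) x * g s x ^+ 2
       - 2 * rho s x * g s x * laplacian Q (g s) x).
    have d := is_derive_mul (drho x st) (is_derive_mul (dg x st) (dg x st)).
    apply: is_derive_eq d _.
    by move: (laplacian Q (g s) x) (laplacian Q (rho s) x) => u v; ring.
  have := is_derive_sumf dx => d; apply: is_derive_eq d _.
  rewrite sumrB -(sum_laplacian_adj (rho s) (fun x => g s x ^+ 2)) -sumrB.
  apply: eq_bigr => x _; rewrite /laplacian !mulr_sumr -sumrB.
  by apply: eq_bigr => y _; ring.
- move=> s /andP[s0 st]; have st' : 0 <= s <= t by rewrite !ltW.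
  rewrite subr_ge0; apply: le_trans (action_le st') _.
  by apply: action_le_energy => x; apply: rho0.
Qed.

End HeatFlow.
End Curvature.

(** * The heat kernel and its Harnack inequality *)

Section HeatKernel.
Variables (R : realType) (X : finType) (Q : X -> X -> R).
Hypothesis Qsym : forall x y, Q x y = Q y x.
Hypothesis Q0 : forall x y, 0 <= Q x y.
Hypothesis Q1 : forall x, \sum_y Q x y = 1.
Implicit Types (f g : X -> R) (t : R) (x y z : X).

Fixpoint transition k x z : R :=
  if k is k'.+1 then \sum_y Q x y * transition k' y z else (x == z)%:R.

Lemma transition_ge0 k x z : 0 <= transition k x z.
Proof.
by elim: k x => [|k IH] x //=; apply: sumr_ge0 => y _; rewrite mulr_ge0.
Qed.

Lemma transition_sum k x : \sum_z transition k x z = 1.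
Proof.
elim: k x => [|k IH] x /=.
  rewrite (bigD1 x) //= eqxx big1 ?addr0 // => z zx.
  by rewrite eq_sym (negbTE zx).
rewrite exchange_big -[RHS](Q1 x); apply: eq_bigr => y _.
by rewrite -mulr_sumr IH mulr1.
Qed.

Lemma transition_le1 k x z : transition k x z <= 1.
Proof.
rewrite -(transition_sum k x) (bigD1 z) //= lerDl.
by apply: sumr_ge0 => y _; apply: transition_ge0.
Qed.

Lemma bounded_transition x z : bounded_coefs (fun k => transition k x z).
Proof.
by apply: bounded_coefs01 => k; rewrite transition_ge0 transition_le1.
Qed.

Lemma transition_sym k x z : transition k x z = transition k z x.
Proof.
suff Sr j u v : transition j.+1 u v = \sum_y transition j u y * Q y v.
  elim: k x z => [|k IH] x z; first by rewrite /= eq_sym.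
  by rewrite Sr /=; apply: eq_bigr => y _; rewrite IH Qsym mulrC.
elim: j u => [|j IH] u.
  rewrite /= (bigD1 v) //= eqxx mulr1 big1 ?addr0 => [|y /negbTE->]; last by rewrite mulr0.
  rewrite (bigD1 u) //= eqxx mul1r big1 ?addr0 // => y yu.
  by rewrite eq_sym (negbTE yu) mul0r.
transitivity (\sum_y Q u y * \sum_w transition j y w * Q w v).
  by apply: eq_bigr => y _; rewrite -IH.
under eq_bigr do rewrite mulr_sumr.
rewrite exchange_big; apply: eq_bigr => y _ /=.
by rewrite mulr_suml; apply: eq_bigr => w _; rewrite mulrA.
Qed.

(** The law of the number of jumps before time [t] is Poisson of mean [t]. *)
Definition heat_kernel t x z : R :=
  expR (- t) * egf (fun k => transition k x z) t.

Lemma heat_kernel_ge0 t x z : 0 <= t -> 0 <= heat_kernel t x z.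
Proof.
move=> t0; rewrite mulr_ge0 ?expR_ge0 //.
have := @egf_ge_partial _ _ t 0 (bounded_transition x z)
  (fun k => transition_ge0 k x z) t0.
by rewrite big_geq.
Qed.

Lemma heat_kernel_sym t x z : heat_kernel t x z = heat_kernel t z x.
Proof.
rewrite /heat_kernel; congr (_ * egf _ t).
by apply/funext => k; apply: transition_sym.
Qed.

Lemma heat_kernel_at0 x z : heat_kernel 0 x z = (x == z)%:R.
Proof. by rewrite /heat_kernel oppr0 expR0 mul1r egf_at0. Qed.

Lemma heat_kernel_sum t x : \sum_z heat_kernel t x z = 1.
Proof.
rewrite -mulr_sumr -egf_sum; last by move=> z; apply: bounded_transition.
rewrite (_ : (fun k => _) = fun=> 1) ?egf_cst1 -?expRD ?addNr ?expR0 //.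
by apply/funext => k; rewrite transition_sum.
Qed.

Lemma egf_transitionS t x z : egf (fun k => transition k.+1 x z) t =
  \sum_y Q x y * egf (fun k => transition k y z) t.
Proof.
rewrite egf_sum /=; last first.
  by move=> y; apply: bounded_coefsZ; apply: bounded_transition.
by apply: eq_bigr => y _; rewrite egfZ //; apply: bounded_transition.
Qed.

Lemma is_derive_heat_kernel t x z : is_derive t 1 (fun s => heat_kernel s x z)
  (laplacian Q (fun y => heat_kernel t y z) x).
Proof.
have d1 : is_derive t 1 (fun s : R => expR (- s)) (expR (- t) * (- 1)).
  exact: (@is_derive_compf _ expR -%R t _ _ (is_derive_expR _) (is_deriveNid t 1)).
have d := is_derive_mul d1 (is_derive_egf t (bounded_transition x z)).
apply: is_derive_eq d _.
rewrite egf_transitionS /laplacian.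
under [RHS]eq_bigr do rewrite mulrBl.
rewrite sumrB -mulr_sumr Q1 mulr1 mulrN1 mulNr addrC; congr (_ - _).
by rewrite mulr_sumr; apply: eq_bigr => y _; rewrite /heat_kernel; ring.
Qed.

Lemma heat_kernel_gt0 t x z : 0 < t ->
  (exists k, 0 < transition k x z) -> 0 < heat_kernel t x z.
Proof.
move=> t0 [k k0]; rewrite mulr_gt0 ?expR_gt0 //.
have := @egf_ge_partial _ _ t k.+1 (bounded_transition x z)
  (fun k => transition_ge0 k x z) (ltW t0).
apply: lt_le_trans; rewrite big_nat_recr //= ltr_wpDl //.
  by apply: sumr_ge0 => i _; rewrite mulr_ge0 ?divr_ge0 ?exprn_ge0 ?transition_ge0 // ltW.
by rewrite mulr_gt0 ?exprn_gt0 // divr_gt0 // ltr0n fact_gt0.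
Qed.

(** The inequality [2 c <= c ^ 2 (k + 1) + 1 / (k + 1)] is summed against the
    probabilities of reaching [z] from [x] in [k] jumps.  On the right, the
    first sum is computed by [k / k! = 1 / (k - 1)!] and gives one more
    step of the chain; the second is a sum over paths with [k + 1] jumps,
    which are at least as likely, up to the factor [a], when started at [y].
    Keeping the free parameter [c] makes the inequality linear in the
    series. *)
Lemma heat_kernel_harnack_linear a t x y z c : 0 < a -> a <= Q y x -> 0 < t ->
  2 * c * heat_kernel t x z <=
  c ^+ 2 * (t * \sum_w Q x w * heat_kernel t w z + heat_kernel t x z)
  + heat_kernel t y z / (a * t).
Proof.
move=> a0 aQ t0.
have hk u : heat_kernel t u z = expR (- t) * egf (fun k => transition k u z) t by [].
have -> : \sum_w Q x w * heat_kernel t w z =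
    expR (- t) * egf (fun k => transition k.+1 x z) t.
  rewrite egf_transitionS mulr_sumr; apply: eq_bigr => w _.
  by rewrite hk mulrCA.
rewrite !hk.
set E := expR (- t).
set u := egf _ t; set v := egf (fun k => _ k.+1 _ _) t; set w := egf _ t.
suff h : 2 * c * u <= c ^+ 2 * (t * v + u) + w / (a * t).
  have := ler_wpM2l (expR_ge0 (- t)) h; rewrite -/E.
  congr (_ <= _); ring.
have tk k : 0 <= t ^+ k by rewrite exprn_ge0 // ltW.
rewrite /u -egfZ; last exact: bounded_transition.
apply: egf_le_partial => [|n]; first by apply/bounded_coefsZ/bounded_transition.
pose U n := \sum_(0 <= k < n) transition k x z / k`!%:R * t ^+ k.
pose V n := \sum_(0 <= k < n) transition k.+1 x z / k`!%:R * t ^+ k.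
pose W n := \sum_(0 <= k < n) transition k y z / k`!%:R * t ^+ k.
have U_le : U n <= u by apply: egf_ge_partial;
  [exact: bounded_transition | move=> k; exact: transition_ge0 | exact: ltW].
have V_le : V n <= v by apply: egf_ge_partial;
  [exact: bounded_shift (bounded_transition x z)
  | move=> k; exact: transition_ge0 | exact: ltW].
have W_le : W n.+1 <= w by apply: egf_ge_partial;
  [exact: bounded_transition | move=> k; exact: transition_ge0 | exact: ltW].
(* The factor [k] cancels in [k!] and shifts the index. *)
have shiftU : \sum_(0 <= k < n) k%:R * (transition k x z / k`!%:R * t ^+ k) <= t * V n.
  case: n {U_le V_le W_le} => [|n].
    by rewrite big_geq // /V big_geq // mulr0.
  rewrite big_nat_recl //= mul0r add0r /V big_nat_recr //= mulrDr ler_wpDr //.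
    by rewrite !mulr_ge0 ?invr_ge0 ?sumr_ge0 // 1?ltW // => i _;
       rewrite mulr_ge0 // ?transition_ge0.
  rewrite mulr_sumr le_eqVlt; apply/orP; left; apply/eqP; apply: eq_bigr => k _.
  rewrite factS natrM exprS /=; field.
  by rewrite nat1r !pnatr_eq0 -lt0n fact_gt0.
(* The factor [1 / (k + 1)] completes [k!] to [(k + 1)!]. *)
have stepW : \sum_(0 <= k < n) (transition k x z / k`!%:R * t ^+ k) / k.+1%:R
    <= W n.+1 / (a * t).
  rewrite /W big_nat_recl //= mulrDl ler_wpDl //.
    by rewrite mulr_ge0 ?invr_ge0 ?mulr_ge0 ?(ltW a0) ?(ltW t0) ?invr_ge0.
  rewrite mulr_suml; apply: ler_sum => k _.
  have kf : (k`!%:R : R) != 0 by rewrite pnatr_eq0 -lt0n fact_gt0.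
  have -> : (\sum_y0 Q y y0 * transition k y0 z) / (k.+1)`!%:R * t ^+ k.+1 / (a * t)
     = (\sum_y0 Q y y0 * transition k y0 z) / a * (t ^+ k / (k.+1)`!%:R).
    rewrite exprS factS natrM; field.
    by rewrite kf !gt_eqF.
  have -> : transition k x z / k`!%:R * t ^+ k / k.+1%:R =
     transition k x z * (t ^+ k / (k.+1)`!%:R).
    by rewrite factS natrM; field; rewrite kf nat1r pnatr_eq0.
  apply: ler_wpM2r; first by rewrite divr_ge0.
  rewrite ler_pdivlMr // (bigD1 x) //= ler_wpDr //.
    by apply: sumr_ge0 => i _; rewrite mulr_ge0 ?transition_ge0.
  by rewrite mulrC ler_wpM2r // transition_ge0.
have c2 : 0 <= c ^+ 2 by exact: sqr_ge0.
apply: (@le_trans _ _ (c ^+ 2 * (t * V n + U n) + W n.+1 / (a * t))); last first.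
  apply: lerD.
    by apply: ler_wpM2l => //; apply: lerD => //; rewrite ler_wpM2l // ltW.
  by rewrite ler_wpM2r // invr_ge0 mulr_ge0 // ltW.
apply: le_trans (lerD (ler_wpM2l c2 (lerD shiftU (lexx _))) stepW).
rewrite /U -big_split mulr_sumr -big_split; apply: ler_sum => k _ /=.
set b := transition k x z / k`!%:R * t ^+ k.
have -> : 2 * c * transition k x z / k`!%:R * t ^+ k = 2 * c * b by rewrite /b; ring.
have -> : c ^+ 2 * (k%:R * b + b) + b / k.+1%:R =
   (c ^+ 2 * k.+1%:R + k.+1%:R^-1) * b by rewrite -natr1; ring.
apply: ler_wpM2r; first by rewrite !mulr_ge0 ?invr_ge0 ?transition_ge0.
have k0 : (0 : R) < k.+1%:R by [].
rewrite -subr_ge0 (_ : _ - _ = (c * k.+1%:R - 1) ^+ 2 / k.+1%:R).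
  by rewrite divr_ge0 ?sqr_ge0.
by field; rewrite nat1r gt_eqF.
Qed.

(** The choice [c = p / (t * S + p)] optimises the linear inequality. *)
Lemma heat_kernel_harnack a t x y z : 0 < a -> a <= Q y x -> 0 < t ->
  0 < heat_kernel t x z ->
  heat_kernel t x z ^+ 2 <=
  heat_kernel t y z / a * (\sum_w Q x w * heat_kernel t w z + heat_kernel t x z / t).
Proof.
move=> a0 aQ t0 p0.
set p := heat_kernel t x z in p0 *; set q := heat_kernel t y z.
set S := \sum_w _.
have S0 : 0 <= S.
  by apply: sumr_ge0 => w _; rewrite mulr_ge0 // heat_kernel_ge0 // ltW.
have m0 : 0 < t * S + p by rewrite ltr_wpDl // mulr_ge0 // ltW.
have := @heat_kernel_harnack_linear a t x y z (p / (t * S + p)) a0 aQ t0.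
rewrite -/p -/q -/S => h.
have {}h : p ^+ 2 / (t * S + p) <= q / (a * t).
  move: h; rewrite -subr_ge0.
  have -> : (p / (t * S + p)) ^+ 2 * (t * S + p) + q / (a * t)
    - 2 * (p / (t * S + p)) * p = q / (a * t) - p ^+ 2 / (t * S + p).
    by field; rewrite !gt_eqF.
  by rewrite subr_ge0.
move: h; rewrite ler_pdivrMr // => h.
apply: le_trans h _; rewrite le_eqVlt; apply/orP; left; apply/eqP.
by field; rewrite !gt_eqF.
Qed.

Definition heat t f x := \sum_z heat_kernel t x z * f z.

Lemma heat_at0 f x : heat 0 f x = f x.
Proof.
rewrite /heat (bigD1 x) //= heat_kernel_at0 eqxx mul1r big1 ?addr0 // => z zx.
by rewrite heat_kernel_at0 eq_sym (negbTE zx) mul0r.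
Qed.

Lemma heat_adj t f g : \sum_x heat t f x * g x = \sum_x f x * heat t g x.
Proof.
under eq_bigr do rewrite mulr_suml.
rewrite exchange_big; apply: eq_bigr => x _; rewrite mulr_sumr.
by apply: eq_bigr => y _; rewrite heat_kernel_sym; ring.
Qed.

Lemma heat_gt0 t f x : 0 <= t -> (forall x, 0 < f x) -> 0 < heat t f x.
Proof.
move=> t0 f0.
have : 0 < \sum_z heat_kernel t x z by rewrite heat_kernel_sum.
have h z : 0 <= heat_kernel t x z by exact: heat_kernel_ge0.
rewrite lt_neqAle sumr_ge0 // andbT => nz.
rewrite lt_neqAle sumr_ge0 ?andbT => [|z _]; last by rewrite mulr_ge0 // ltW.
apply: contra nz; rewrite ![0 == _]eq_sym !psumr_eq0 //; last first.
  by move=> z _; rewrite mulr_ge0 // ltW.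
by apply: sub_all => z /=; rewrite mulf_eq0 (gt_eqF (f0 z)) orbF.
Qed.

Lemma is_derive_heat t f x :
  is_derive t 1 (fun s => heat s f x) (laplacian Q (heat t f) x).
Proof.
have := is_derive_sumf (fun z => is_derive_mulC (f z) (is_derive_heat_kernel t x z)).
move=> d; apply: is_derive_eq d _.
rewrite /laplacian; under eq_bigr do rewrite mulr_suml.
rewrite exchange_big; apply: eq_bigr => y _; rewrite /heat -sumrB mulr_suml.
by apply: eq_bigr => z _; ring.
Qed.

End HeatKernel.

(** * Elementary inequalities *)

Section XLnX.
Variable R : realType.
Implicit Types u x : R.

(** A form of [ln u <= 2 sqrt u] in which [l], later optimised, replaces the
    square root. *)
Lemma ln_le_split (l u : R) : 0 < l -> 0 < u -> ln u <= l + u / l.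
Proof.
move=> l0 u0; have -> : ln u = ln l + ln (u / l).
  by rewrite ln_div ?posrE // addrC subrK.
apply: lerD; first exact/ltW/ln_sublinear.
by apply/ltW/ln_sublinear; rewrite divr_gt0.
Qed.

(** Since [- ln u = 2 ln (1 / sqrt u)], sublinearity of [ln] suffices. *)
Lemma normr_xlnx_le u : `|u| <= 1 -> `|u * ln u| <= 2 * Num.sqrt `|u|.
Proof.
have [u0|u0 u1] := leP u 0.
  by rewrite ln0 // mulr0 normr0 mulr_ge0 ?sqrtr_ge0.
have s0 : 0 < Num.sqrt u by rewrite sqrtr_gt0.
rewrite (gtr0_norm u0) in u1 *.
rewrite ler0_norm; last by rewrite mulr_ge0_le0 ?ln_le0 // ltW.
have -> : - (u * ln u) = 2 * Num.sqrt u * (Num.sqrt u * ln (Num.sqrt u)^-1).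
  rewrite lnV ?posrE // -{1 2}(sqr_sqrtr (ltW u0)) lnXn // -mulr_natl; ring.
rewrite ger_pMr ?mulr_gt0 // mulrC -ler_pdivlMr // mul1r.
by apply/ltW/ln_sublinear; rewrite invr_gt0.
Qed.

Lemma continuous_xlnx u : {for u, continuous (fun u => u * ln u)}.
Proof.
have [u0|u0|->] := ltgtP u 0.
- rewrite /prop_for /continuous_at (ln0 (ltW u0)) mulr0.
  apply: cvg_near_cst; near=> v; rewrite ln0 ?mulr0 //.
  by apply: ltW; near: v; exact: (cvgr_lt u).
- by apply: cvgM; [exact: cvg_id | exact: continuous_ln].
- rewrite /prop_for /continuous_at mul0r; apply: norm_cvg0.
  apply: (@squeeze_cvgr _ _ _ _ (cst 0) (fun v => 2 * Num.sqrt `|v|)).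
  + near=> v; rewrite normr_ge0 /=; apply: normr_xlnx_le.
    apply: ltW; near: v; apply: (cvgr_lt `|0 : R|); first exact: norm_continuous.
    by rewrite normr0.
  + exact: cvg_cst.
  + rewrite [X in _ --> X](_ : 0 = 2 * Num.sqrt `|0 : R|); last first.
      by rewrite normr0 sqrtr0 mulr0.
    apply: cvgMr; apply: continuous_comp; first exact: norm_continuous.
    exact: sqrt_continuous.
Unshelve. all: by end_near. Qed.

Lemma is_derive_xlnx u : 0 < u -> is_derive u 1 (fun u => u * ln u) (ln u + 1).
Proof.
move=> u0; have d := is_derive_mul (is_derive_id u (1:R)) (is_derive1_ln u0).
by apply: is_derive_eq d _; rewrite mul1r divff ?gt_eqF.
Qed.

Lemma le_of_affine (A B C : R) : 0 <= C ->
  (forall M, 1 <= M -> A * M <= B * M + C) -> A <= B.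
Proof.
move=> C0 h; rewrite leNgt; apply/negP => BA.
have AB : 0 < A - B by rewrite subr_gt0.
have := h (C / (A - B) + 1); rewrite lerDr divr_ge0 ?(ltW AB) // => /(_ isT).
apply/negP; rewrite -ltNge -subr_gt0.
rewrite (_ : _ - _ = A - B) //; field.
by rewrite gt_eqF.
Qed.

End XLnX.

Section PartialSums.
Variables (R : numDomainType) (I : finType) (G : I -> R).
Hypothesis G0 : forall i, 0 <= G i.

Lemma term_le_sum i : G i <= \sum_j G j.
Proof. by rewrite (bigD1 i) //= lerDl; apply: sumr_ge0. Qed.

Lemma term2_le_sum i j : i != j -> G i + G j <= \sum_k G k.
Proof.
move=> ij; rewrite (bigD1 i) //= (bigD1 j) 1?eq_sym //= addrA lerDl.
exact: sumr_ge0.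
Qed.

End PartialSums.

Section Jeffreys.
Variable (R : realType).
Implicit Types p q l : R.

(** For [q < p] the bound [ln_le_split] is used on [p / q] with parameter
    [l * (p - q) / p], chosen so that the two resulting terms are
    [l * (p - q) ^ 2 / p] and [p ^ 2 / (l * q)]; the factor 2 passes from [p] to
    the symmetric denominator [p + q]. *)
Lemma jeffreys_le p q l : 0 < p -> 0 < q -> 0 < l ->
  (p - q) * (ln p - ln q) <=
  2 * l * ((p - q) ^+ 2 / (p + q)) + (p ^+ 2 / q + q ^+ 2 / p) / l.
Proof.
wlog qp : p q / q <= p => [h p0 q0 l0|p0 q0 l0].
  have [|/ltW pq] := leP q p => [qp|]; first exact: h.
  have := h q p pq q0 p0 l0; congr (_ <= _); first by ring.
  by rewrite -(opprB p q) sqrrN (addrC q p) (addrC (q ^+ 2 / p)).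
have pq0 : 0 < p + q by rewrite addr_gt0.
have [<-|pq] := eqVneq q p.
  rewrite subrr mul0r expr0n /= mul0r mulr0 add0r.
  by rewrite divr_ge0 ?addr_ge0 ?divr_ge0 ?sqr_ge0 // ltW.
have d0 : 0 < p - q by rewrite subr_gt0 lt_neqAle pq qp.
have c0 : 0 < l * (p - q) / p by rewrite !mulr_gt0 ?invr_gt0.
rewrite -ln_div ?posrE //.
apply: le_trans (ler_wpM2l (ltW d0) (ln_le_split c0 (divr_gt0 p0 q0))) _.
have -> : (p - q) * (l * (p - q) / p + p / q / (l * (p - q) / p)) =
   l * ((p - q) ^+ 2 / p) + p ^+ 2 / q / l.
  by field; rewrite !gt_eqF.
apply: lerD.
  have -> : 2 * l * ((p - q) ^+ 2 / (p + q)) = l * (p - q) ^+ 2 * (2 / (p + q)).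
    by ring.
  rewrite mulrA ler_pM2l ?mulr_gt0 ?exprn_gt0 // ler_pdivlMr // mulrC.
  by rewrite ler_pdivrMr //; lra.
rewrite ler_pM2r ?invr_gt0 // lerDl.
by rewrite divr_ge0 ?sqr_ge0 // ltW.
Qed.

End Jeffreys.

(** * Growth of the entropy under non-negative curvature *)

Section EntropyProduction.
Variables (R : realType) (X : finType) (Q : X -> X -> R) (a : R).
Hypothesis Qsym : forall x y, Q x y = Q y x.
Hypothesis Q0 : forall x y, 0 <= Q x y.
Hypothesis Q1 : forall x, \sum_y Q x y = 1.
Hypothesis Qdiag : forall x, Q x x = 0.
Hypothesis a0 : 0 < a.
Hypothesis Qa : forall x y, 0 < Q x y -> a <= Q x y.
Hypothesis Qirr : forall x z, exists k, 0 < transition Q k x z.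
Hypothesis CD : CDent_nonneg Q (@srw_measure R X).
Implicit Types (f g : X -> R) (t : R) (x y z : X).

Local Notation P := (heat_kernel Q).

(** The reverse Poincare inequality is applied to the density [rho] equal to
    a large [M] at [x] and [y] and to [1] elsewhere, for which the logarithmic
    mean on the edge is [M] itself.  Both sides are affine in [M], and
    [le_of_affine] compares the slopes. *)
Lemma heat_gradient t f x y : 0 < Q x y -> 0 <= t ->
  2 * t * a * (heat Q t f x - heat Q t f y) ^+ 2 <=
  heat Q t (fun z => f z ^+ 2) x + heat Q t (fun z => f z ^+ 2) y.
Proof.
move=> Qxy t0; set h := heat Q t (fun z => f z ^+ 2).
have xy : x != y by apply: contraTneq Qxy => ->; rewrite Qdiag ltxx.
have h0 z : 0 <= h z.
  by apply: sumr_ge0 => w _; rewrite mulr_ge0 ?sqr_ge0 // heat_kernel_ge0.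
apply: (@le_of_affine _ _ _ (\sum_z h z)); first exact: sumr_ge0.
move=> M M1.
have M0 : 0 < M by rewrite (lt_le_trans _ M1).
pose rho z := if (z == x) || (z == y) then M else 1.
have rho0 z : 0 < rho z by rewrite /rho; case: ifP.
have : t * action Q (heat Q 0 rho) (heat Q (t - 0) f) <=
    \sum_x heat Q t rho x * heat Q (t - t) f x ^+ 2.
  apply: (@reverse_poincare _ _ Q Qsym Q0 (fun s => heat Q s rho)
    (fun s => heat Q (t - s) f)) => //.
  - by move=> s z /andP[s0 _]; apply: heat_gt0.
  - by move=> s z _; apply: is_derive_heat.
  move=> s z _.
  have d : is_derive s 1 (fun u : R => t - u) (-1).
    have := is_deriveB (is_derive_cst t s (1:R)) (is_derive_id s (1:R)).
    by rewrite sub0r.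
  have := @is_derive_compf _ (fun u => heat Q u f z) (fun u => t - u) s _ _
    (is_derive_heat Q0 Q1 (t - s) f z) d.
  by rewrite mulrN1.
have e0 u : heat Q 0 u = u by apply/funext => z; rewrite heat_at0.
rewrite subr0 subrr !e0.
rewrite heat_adj // -/h => H.
have rhs : \sum_z rho z * h z <= (h x + h y) * M + \sum_z h z.
  rewrite -lerBlDr -sumrB (bigD1 x) //= (bigD1 y) 1?eq_sym //= big1 ?addr0.
    rewrite /rho !eqxx orbT /= mulrDl (mulrC (h x)) (mulrC (h y)).
    by apply: lerD; rewrite lerBlDr lerDl.
  by move=> z /andP[/negbTE zx /negbTE zy]; rewrite /rho zx zy mul1r subrr.
apply: le_trans (le_trans H rhs).
have -> : 2 * t * a * (heat Q t f x - heat Q t f y) ^+ 2 * M =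
  t * (a * (2 * M * (heat Q t f x - heat Q t f y) ^+ 2)) by ring.
apply: ler_wpM2l => //.
pose F u v := theta_log (rho u) (rho v) * (heat Q t f u - heat Q t f v) ^+ 2 * Q u v.
have F0 u v : 0 <= F u v.
  apply: mulr_ge0 => //; apply: mulr_ge0; last exact: sqr_ge0.
  exact: theta_log_ge0.
have FS u : 0 <= \sum_v F u v by apply: sumr_ge0.
apply: (@le_trans _ _ (F x y + F y x)); last first.
  apply: le_trans (term2_le_sum FS xy).
  by apply: lerD; apply: (term_le_sum (F0 _)).
rewrite /F /rho !eqxx orbT /= theta_log_diag // (Qsym y x).
have -> : M * (heat Q t f x - heat Q t f y) ^+ 2 * Q x y +
  M * (heat Q t f y - heat Q t f x) ^+ 2 * Q x y =
  Q x y * (2 * M * (heat Q t f x - heat Q t f y) ^+ 2) by ring.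
apply: ler_wpM2r; last exact: Qa.
apply: mulr_ge0; last exact: sqr_ge0.
by rewrite mulr_ge0 // ltW.
Qed.

Lemma heat_kernel_pos t x z : 0 < t -> 0 < P t x z.
Proof. by move=> t0; apply: heat_kernel_gt0. Qed.

(** The triangular discrimination (Vincze - Le Cam divergence) of the heat
    kernels from [x] and from [y]. *)
Definition triangular t x y := \sum_z (P t x z - P t y z) ^+ 2 / (P t x z + P t y z).

Lemma triangular_ge0 t x y : 0 < t -> 0 <= triangular t x y.
Proof.
move=> t0; apply: sumr_ge0 => z _; rewrite divr_ge0 ?sqr_ge0 //.
by rewrite addr_ge0 ?(ltW (heat_kernel_pos _ _ _)).
Qed.

Lemma triangular_le2 t x y : 0 < t -> triangular t x y <= 2.
Proof.
move=> t0; rewrite (_ : 2 = \sum_z (P t x z + P t y z)); last first.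
  by rewrite big_split /= !heat_kernel_sum.
apply: ler_sum => z _; have p0 := heat_kernel_pos x z t0; have q0 := heat_kernel_pos y z t0.
rewrite ler_pdivrMr ?addr_gt0 // -expr2 -subr_ge0.
rewrite (_ : _ - _ = 4 * (P t x z * P t y z)); last by ring.
by apply: mulr_ge0 => //; apply: mulr_ge0; apply: ltW.
Qed.

(** The function [f = (p - q) / (p + q)] is extremal in the gradient bound: both
    [sum (p - q) f] and [sum (p + q) f ^ 2] are then the discrimination
    itself. *)
Lemma triangular_le t x y : 0 < Q x y -> 0 < t -> triangular t x y <= (2 * t * a)^-1.
Proof.
move=> Qxy t0.
pose f z := (P t x z - P t y z) / (P t x z + P t y z).
have := heat_gradient f Qxy (ltW t0).
have pq z : P t x z + P t y z != 0 by rewrite gt_eqF // addr_gt0 // heat_kernel_pos.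
have -> : heat Q t f x - heat Q t f y = triangular t x y.
  rewrite /heat -sumrB; apply: eq_bigr => z _; rewrite /f.
  by field.
have -> : heat Q t (fun z => f z ^+ 2) x + heat Q t (fun z => f z ^+ 2) y = triangular t x y.
  rewrite /heat -big_split; apply: eq_bigr => z _; rewrite /f /=.
  by field.
have c0 : 0 < 2 * t * a by rewrite !mulr_gt0.
have := triangular_ge0 x y t0; rewrite le_eqVlt => /predU1P[<- _|T0].
  by rewrite invr_ge0 ltW.
rewrite expr2 mulrA -ler_pdivlMr // divff ?gt_eqF // => h.
by rewrite -[leRHS]mul1r ler_pdivlMr // mulrC.
Qed.

Lemma sum_sq_ratio_le t x y : 0 < Q y x -> 0 < t ->
  \sum_z P t x z ^+ 2 / P t y z <= (1 + t^-1) / a.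
Proof.
move=> Qyx t0.
have -> : (1 + t^-1) / a =
    \sum_z a^-1 * (\sum_w Q x w * P t w z + P t x z / t).
  rewrite -mulr_sumr big_split /= -mulr_suml heat_kernel_sum // mul1r mulrC.
  congr (_ * (_ + _)); rewrite exchange_big /= -(Q1 x); apply: eq_bigr => w _.
  by rewrite -mulr_sumr heat_kernel_sum // mulr1.
apply: ler_sum => z _; have q0 := heat_kernel_pos y z t0.
rewrite ler_pdivrMr // [leRHS]mulrC mulrA.
by apply: heat_kernel_harnack => //; [exact: Qa | exact: heat_kernel_pos].
Qed.

Definition jeffreys t x y :=
  \sum_z (P t x z - P t y z) * (ln (P t x z) - ln (P t y z)).

(** The parameter of [jeffreys_le] is [sqrt t] for large [t], and [1 / sqrt t]
    for small [t], where the trivial bound 2 on the discrimination keeps the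
    estimate integrable at [t = 0]. *)
Lemma jeffreys_bound t x y : a <= 1 -> 0 < Q x y -> 0 < t ->
  jeffreys t x y <= 8 / (a * Num.sqrt t).
Proof.
move=> a1 Qxy t0; have Qyx : 0 < Q y x by rewrite Qsym.
have gen l : 0 < l -> jeffreys t x y <= 2 * l * triangular t x y + 2 * ((1 + t^-1) / a) / l.
  move=> l0; rewrite /jeffreys.
  apply: le_trans (ler_sum _ (fun z _ =>
    jeffreys_le (heat_kernel_pos x z t0) (heat_kernel_pos y z t0) l0)) _.
  rewrite big_split /= -mulr_sumr lerD2l -mulr_suml ler_pM2r ?invr_gt0 //.
  rewrite big_split /= (_ : 2 * _ = (1 + t^-1) / a + (1 + t^-1) / a); last by ring.
  by apply: lerD; apply: sum_sq_ratio_le.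
have s0 : 0 < Num.sqrt t by rewrite sqrtr_gt0.
have st : t = Num.sqrt t ^+ 2 by rewrite sqr_sqrtr // ltW.
set s := Num.sqrt t in s0 st *.
have as0 : 0 < a * s by rewrite mulr_gt0.
have [t1|t1] := leP 1 t.
  apply: le_trans (gen _ s0) _.
  apply: (@le_trans _ _ (2 * s * (2 * t * a)^-1 + 2 * ((1 + 1) / a) / s)).
    apply: lerD.
      by apply: ler_wpM2l; [rewrite mulr_ge0 // ltW | exact: triangular_le].
    rewrite ler_pM2r ?invr_gt0 // ler_pM2l // ler_pM2r ?invr_gt0 //.
    by rewrite lerD2l invf_le1.
  have -> : 2 * s * (2 * t * a)^-1 + 2 * ((1 + 1) / a) / s = 5 / (a * s).
    by rewrite st; field; rewrite !gt_eqF.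
  by rewrite ler_pM2r ?invr_gt0 // ler_nat.
have is0 : 0 < s^-1 by rewrite invr_gt0.
apply: le_trans (gen _ is0) _.
apply: (@le_trans _ _ (2 * s^-1 * 2 / a + 2 * ((t^-1 + t^-1) / a) / s^-1)).
  apply: lerD.
    rewrite -[2 * s^-1 * 2 / a]mulrA ler_pM2l ?mulr_gt0 //.
    apply: le_trans (triangular_le2 x y t0) _.
    by rewrite ler_pdivlMr // ger_pMr.
  rewrite ler_pM2r ?invr_gt0 // ler_pM2l // ler_pM2r ?invr_gt0 //.
  by rewrite lerD2r -[leLHS]invr1 lef_pV2 ?posrE // ltW.
rewrite le_eqVlt; apply/orP; left; apply/eqP.
by rewrite st; field; rewrite !gt_eqF.
Qed.

(** The sum of the entropies of [P t x] over all starting points [x].  Summing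
    over [x] allows the time derivative to act on the starting point, so that
    kernels started at the two ends of an edge are compared. *)
Definition entropy t := - \sum_x \sum_z P t x z * ln (P t x z).

Lemma sum_laplacian_dirichlet f g : \sum_x f x * laplacian Q g x =
  - (2^-1 * \sum_x \sum_y Q x y * ((f x - f y) * (g x - g y))).
Proof.
pose F x y := - 2^-1 * (Q x y * (f x * (g x - g y))).
transitivity (\sum_x \sum_y F x y + \sum_x \sum_y F y x).
  rewrite (sum_swap F) -[RHS]mulr2n -[RHS]mulr_natl mulr_sumr; apply: eq_bigr => x _.
  rewrite /laplacian !mulr_sumr; apply: eq_bigr => y _; rewrite /F.
  by field.
rewrite mulr_sumr -sumrN -big_split; apply: eq_bigr => x _ /=.
rewrite mulr_sumr -sumrN -big_split; apply: eq_bigr => y _ /=.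
by rewrite /F (Qsym y x); ring.
Qed.

Lemma is_derive_entropy t : 0 < t ->
  is_derive t 1 entropy (2^-1 * \sum_x \sum_y Q x y * jeffreys t x y).
Proof.
move=> t0.
have d x z : is_derive t 1 (fun s => P s x z * ln (P s x z))
   ((ln (P t x z) + 1) * laplacian Q (fun y => P t y z) x).
  apply: (@is_derive_compf _ (fun u => u * ln u) (fun s => P s x z)).
    by apply: is_derive_xlnx; exact: heat_kernel_pos.
  exact: is_derive_heat_kernel.
have := is_deriveN (is_derive_sumf (fun x => is_derive_sumf (fun z => d x z))).
move=> D; apply: is_derive_eq D _.
rewrite exchange_big /=.
under eq_bigr do rewrite sum_laplacian_dirichlet.
rewrite sumrN opprK -mulr_sumr; congr (_ * _).
rewrite exchange_big; apply: eq_bigr => x _.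
rewrite exchange_big; apply: eq_bigr => y _.
rewrite /jeffreys mulr_sumr; apply: eq_bigr => z _.
by rewrite /=; ring.
Qed.

Lemma continuous_entropy t : {for t, continuous entropy}.
Proof.
apply: cvgN; apply: continuous_sumf => x; apply: continuous_sumf => z.
apply: (@continuous_comp _ _ _ (fun s => P s x z) (fun u => u * ln u)).
  exact: is_derive_continuous (is_derive_heat_kernel Q0 Q1 t x z).
exact: continuous_xlnx.
Qed.

Lemma entropy_at0 : entropy 0 = 0.
Proof.
rewrite /entropy big1 ?oppr0 // => x _; rewrite big1 // => z _.
by rewrite heat_kernel_at0; case: eqP => _; rewrite ?mul0r // ln1 mulr0.
Qed.

Lemma entropy_le t : a <= 1 -> 0 <= t ->
  entropy t <= 8 * #|X|%:R * Num.sqrt t / a.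
Proof.
move=> a1 t0.
pose K := 8 * #|X|%:R / a.
pose F s := K * Num.sqrt s - entropy s.
have : F 0 <= F t.
  apply: (@le_of_ge0_derive_oo _ F (fun s => (2 * Num.sqrt s)^-1 * K -
    (2^-1 * \sum_x \sum_y Q x y * jeffreys s x y))) => //.
  - move=> s _; apply: cvgB; last exact: continuous_entropy.
    by apply: cvgMr; exact: sqrt_continuous.
  - move=> s /andP[s0 _]; apply: is_deriveB; last exact: is_derive_entropy.
    have := is_derive_mulC K (is_derive1_sqrt s0).
    by rewrite (_ : (fun t => _) = (fun s => K * Num.sqrt s)) //; apply/funext => u; rewrite mulrC.
  - move=> s /andP[s0 _]; rewrite subr_ge0.
    have r0 : 0 < Num.sqrt s by rewrite sqrtr_gt0.
    rewrite invfM -mulrA ler_pM2l ?invr_gt0 //.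
    have -> : (Num.sqrt s)^-1 * K = \sum_(x : X) 8 / (a * Num.sqrt s).
      rewrite sumr_const -[RHS]mulr_natl /K; field.
      by rewrite !gt_eqF.
    apply: ler_sum => x _.
    have -> : 8 / (a * Num.sqrt s) = \sum_y Q x y * (8 / (a * Num.sqrt s)).
      by rewrite -mulr_suml Q1 mul1r.
    apply: ler_sum => y _.
    have := Q0 x y; rewrite le_eqVlt => /predU1P[<-|Qxy]; first by rewrite !mul0r.
    by rewrite ler_pM2l // jeffreys_bound.
rewrite /F sqrtr0 mulr0 entropy_at0 subrr subr_ge0 /K => h.
by rewrite mulrAC.
Qed.

(** Jensen's inequality for the logarithm, in the form of its tangent at
    [c]. *)
Lemma entropy_ge t c : 0 < t -> 0 < c ->
  (forall x, \sum_z P t x z ^+ 2 <= c) -> - ln c * #|X|%:R <= entropy t.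
Proof.
move=> t0 c0 h.
rewrite /entropy -sumrN mulrC mulr_natl -sumr_const; apply: ler_sum => x _.
rewrite -sumrN.
apply: (@le_trans _ _ (\sum_z (P t x z * (1 - ln c) - P t x z ^+ 2 / c))).
  rewrite sumrB -mulr_suml heat_kernel_sum // mul1r -mulr_suml.
  rewrite -subr_ge0 (_ : _ - _ = 1 - (\sum_z P t x z ^+ 2) / c); last by ring.
  by rewrite subr_ge0 ler_pdivrMr // mul1r.
apply: ler_sum => z _; have p0 := heat_kernel_pos x z t0.
rewrite (_ : _ - _ = P t x z * (1 - ln c - P t x z / c)); last by ring.
rewrite -[leRHS]mulrN ler_pM2l //.
have : ln (P t x z / c) <= P t x z / c - 1.
  rewrite -[X in ln X](subrKC 1) le_ln1Dx //.
  by rewrite ltrBrDl subrr divr_gt0.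
rewrite ln_div ?posrE // => H; lra.
Qed.

End EntropyProduction.

(** * The second eigenvalue of a symmetric matrix *)

Section Spectral.
Local Open Scope sesquilinear_scope.
Variables (R : realType) (n : nat).
Implicit Types (A : 'M[R]_n) (u f : 'rV[R]_n).

Let toC : {rmorphism R -> R[i]} := real_complex R.

(** The eigenvectors given by the spectral theorem are complex, but the
    eigenvalues are real and, by comparison of characteristic polynomials, are
    those listed by [eigenvalues]. *)
Lemma symmetric_diagonalization A : A^T = A ->
  exists (P : 'M[R[i]]_n) (r : 'I_n -> R),
  [/\ P \is unitarymx,
      map_mx toC A = P^t* *m diag_mx (\row_i toC (r i)) *m P
    & perm_eq (eigenvalues A) [seq r i | i <- enum 'I_n]].
Proof.
move=> symA.
pose B := map_mx toC A.
have hB : B \is hermsymmx.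
  apply: realsym_hermsym.
    apply/is_hermitianmxP; rewrite expr0 scale1r map_mx_id //.
    by apply/matrixP => i j; rewrite !mxE -{1}symA mxE.
  apply/mxOverP => i j; rewrite mxE; apply/complex_realP.
  by exists (A i j).
have /mxOverP rB := hermitian_spectral_diag_real hB.
have /hermitian_normalmx/orthomx_spectralP eB := hB.
set D := spectral_diag B in rB eB; set P := spectralmx B in eB.
have uP : P \is unitarymx by exact: spectral_unitarymx.
have unP : P \in unitmx by exact: spectral_unit.
pose r i := complex.Re (D 0 i).
have Dr : D = \row_i toC (r i).
  by apply/rowP => i; rewrite mxE; apply/esym/RRe_real; apply: rB.
exists P, r; split => //.
  by rewrite -invmx_unitary // -Dr -eB.
have [_ eE] := eigenvalues_symP symA.
have : char_poly A = \prod_(x <- [seq r i | i <- enum 'I_n]) ('X - x%:P).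
  apply: (map_poly_inj toC).
  rewrite map_char_poly -/B rmorph_prod /= big_map.
  have -> : char_poly B = char_poly (diag_mx D).
    rewrite eB /char_poly.
    have -> : char_poly_mx (invmx P *m diag_mx D *m P) =
        map_mx polyC (invmx P) *m char_poly_mx (diag_mx D) *m map_mx polyC P.
      rewrite /char_poly_mx !map_mxM mulmxBr mulmxBl; congr (_ - _).
      by rewrite mul_mx_scalar -scalemxAl -map_mxM mulVmx // map_mx1 scalemx1.
    rewrite !det_mulmx mulrAC -det_mulmx -map_mxM mulVmx //.
    by rewrite map_mx1 det1 mul1r.
  rewrite char_poly_trig ?diag_mx_is_trig // big_enum /=; apply: eq_bigr => i _.
  rewrite mxE eqxx mulr1n rmorphB /= map_polyX map_polyC /=.
  by congr (_ - _%:P); apply/esym; apply: RRe_real; apply: rB.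
rewrite eE => pE; apply/allP => x _ /=; apply/eqP.
by rewrite -!mu_prod_XsubC pE.
Qed.

End Spectral.

Section SecondEigenvalue.
Local Open Scope sesquilinear_scope.
Variables (R : realType) (n : nat) (A : 'M[R]_n) (c : R) (u : 'rV[R]_n).
Hypothesis symA : A^T = A.
Hypothesis uA : u *m A = c *: u.
Hypothesis u0 : u != 0.
Hypothesis spec_le : forall a, eigenvalue A a -> a <= c.

Local Notation mu := (nth 0 (eigenvalues A) 1).

Let toC : {rmorphism R -> R[i]} := real_complex R.

Lemma size_eigenvalues : size (eigenvalues A) = n.
Proof.
have [P [r [_ _ /perm_size ->]]] := symmetric_diagonalization symA.
by rewrite size_map size_enum_ord.
Qed.

Lemma mem_eigenvalues_le a : a \in eigenvalues A -> a <= c.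
Proof.
have [_ e] := eigenvalues_symP symA.
move=> h; apply: spec_le; rewrite eigenvalue_root_char e.
by rewrite root_prod_XsubC.
Qed.

Lemma second_eigenvalue_le : (1 < n)%N -> mu <= c.
Proof. by move=> n1; apply/mem_eigenvalues_le/mem_nth; rewrite size_eigenvalues. Qed.

(** The list of eigenvalues is sorted decreasingly, so that only its head can
    exceed the entry of index 1. *)
Lemma second_eigenvalue_unique (r : 'I_n -> R) i j :
  perm_eq (eigenvalues A) [seq r i | i <- enum 'I_n] ->
  mu < r i -> mu < r j -> i = j.
Proof.
move=> pe ri rj; apply/eqP/negPn/negP => ij.
have [so _] := eigenvalues_symP symA.
have : (1 < count (fun x => (mu < x)%R) (eigenvalues A))%N.
  rewrite (permP pe) count_map -size_filter.
  apply: (@uniq_leq_size _ [:: i; j]); first by rewrite /= inE ij.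
  by move=> k; rewrite !inE mem_filter mem_enum andbT => /orP[] /eqP -> /=.
apply/negP; rewrite -leqNgt.
case: (eigenvalues A) so => [|x [|y l]] //=; first by rewrite addn0 leq_b1.
move=> /andP[_ yl]; rewrite ltxx add0n (eq_in_count (a2 := pred0)) ?count_pred0 ?addn0 ?leq_b1 //.
move=> z zl /=; apply/negbTE; rewrite -leNgt.
have ge_tr : transitive (>=%R : rel R) by move=> v w t vw wt; apply: le_trans wt vw.
by move: yl; rewrite (path_sortedE ge_tr) => /andP[/allP /(_ _ zl)].
Qed.

(** In the eigenbasis, [G] and [W] are the coordinates of [f] and of [u].  If an
    eigenvalue [r i] exceeds [mu], then so does the top eigenvalue [c], which
    is therefore simple; as [u] is an eigenvector for [c], it spans the
    [i]-th axis, and orthogonality of [f] and [u] gives [G 0 i = 0]. *)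
Lemma rayleigh_second_eigenvalue (f : 'rV[R]_n) : f *m u^T = 0 ->
  (f *m A *m f^T) 0 0 <= mu * (f *m f^T) 0 0.
Proof.
move=> fu.
have [P [r [uP eA pe]]] := symmetric_diagonalization symA.
have PP : P *m P^t* = 1%:M by apply/unitarymxP.
have P'P : P^t* *m P = 1%:M.
  by rewrite -invmx_unitary // mulVmx // unitarymx_unit.
pose G := map_mx toC f *m P^t*; pose W := map_mx toC u *m P^t*.
have conjR m k (B : 'M[R]_(m, k)) : (map_mx toC B)^t* = map_mx toC B^T.
  apply/matrixP => i j; rewrite !mxE; apply: conj_Creal.
  by apply/complex_realP; exists (B j i).
have adjM m k l (B : 'M[R[i]]_(m, k)) (C : 'M[R[i]]_(k, l)) :
    (B *m C)^t* = C^t* *m B^t* by rewrite trmx_mul map_mxM.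
have adjE m k (B : 'M[R[i]]_(m, k)) i j : (B^t*) i j = (B j i)^*.
  by rewrite !mxE.
have GE : G *m G^t* = map_mx toC (f *m f^T).
  rewrite /G adjM trmxCK mulmxA -(mulmxA _ _ P) P'P mulmx1.
  by rewrite conjR -map_mxM.
have GW : G *m W^t* = 0.
  rewrite /G /W adjM trmxCK mulmxA -(mulmxA _ _ P) P'P mulmx1.
  by rewrite conjR -map_mxM fu map_mx0.
have GA : G *m diag_mx (\row_i toC (r i)) *m G^t* = map_mx toC (f *m A *m f^T).
  rewrite /G adjM trmxCK !map_mxM eA conjR.
  by rewrite -!mulmxA.
have WD i : W 0 i != 0 -> r i = c.
  have : W *m diag_mx (\row_i toC (r i)) = toC c *: W.
    have eAP : map_mx toC A *m P^t* = P^t* *m diag_mx (\row_i toC (r i)).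
      by rewrite eA -!mulmxA PP mulmx1.
    by rewrite /W -mulmxA -eAP mulmxA -map_mxM uA map_mxZ -scalemxAl.
  move=> /rowP /(_ i); rewrite mul_mx_diag !mxE => e W0.
  by move: e; rewrite mulrC => /(mulIf W0) /complexI.
have [i0 Wi0] : exists i, W 0 i != 0.
  apply/existsP; apply: contraNT u0 => /existsPn h.
  have W0 : W = 0.
    by apply/rowP => i; rewrite [RHS]mxE; apply/eqP; move: (h i); rewrite negbK.
  have : map_mx toC u = 0.
    by rewrite -[LHS]mulmx1 -P'P mulmxA -/W W0 mul0mx.
  by move=> /eqP; rewrite map_mx_eq0.
have key i : toC (r i) * (G 0 i * (G 0 i)^*) <= toC mu * (G 0 i * (G 0 i)^*).
  have [ri|ri] := leP (r i) mu.
    by rewrite ler_wpM2r ?mul_conjC_ge0 // lecR.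
  suff -> : G 0 i = 0 by rewrite mul0r !mulr0.
  have muc : mu < c.
    apply: lt_le_trans ri _; apply: mem_eigenvalues_le.
    by rewrite (perm_mem pe); apply: map_f; rewrite mem_enum.
  have W_i j : j != i -> W 0 j = 0.
    move=> ji; apply/eqP; apply: contraNT ji => Wj.
    apply/eqP/(second_eigenvalue_unique pe) => //.
    by rewrite (WD j).
  move: GW => /matrixP /(_ 0 0).
  rewrite [LHS]mxE [RHS]mxE (bigD1 i) //= big1 => [|j ji].
    rewrite addr0 adjE => /eqP; rewrite mulf_eq0 conjC_eq0 => /orP[/eqP //|].
    have [<-|ii] := eqVneq i0 i; first by rewrite (negbTE Wi0).
    by move: Wi0; rewrite W_i // eqxx.
  by rewrite adjE W_i // conjC0 mulr0.
have : \sum_i toC (r i) * (G 0 i * (G 0 i)^*) <= toC mu * \sum_i (G 0 i * (G 0 i)^*).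
  by rewrite mulr_sumr; apply: ler_sum => i _; apply: key.
have -> : \sum_i toC (r i) * (G 0 i * (G 0 i)^*) = toC ((f *m A *m f^T) 0 0).
  move: GA => /matrixP /(_ 0 0); rewrite [RHS]mxE => <-.
  rewrite mul_mx_diag mxE; apply: eq_bigr => i _.
  by rewrite adjE [X in _ = X * _]mxE [X in _ = _ * X * _]mxE mulrCA mulrA.
have -> : \sum_i (G 0 i * (G 0 i)^*) = toC ((f *m f^T) 0 0).
  move: GE => /matrixP /(_ 0 0); rewrite [RHS]mxE => <-.
  by rewrite mxE; apply: eq_bigr => i _; rewrite adjE.
by rewrite -rmorphM lecR.
Qed.

End SecondEigenvalue.

(** * Spectral gap and decay of the heat kernel *)

Section SpectralGap.
Variables (R : realType) (X : finType) (Q : X -> X -> R) (lam : R).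
Hypothesis Qsym : forall x y, Q x y = Q y x.
Hypothesis Q0 : forall x y, 0 <= Q x y.
Hypothesis Q1 : forall x, \sum_y Q x y = 1.
Hypothesis gap : forall f, \sum_x f x = 0 ->
  \sum_x f x * laplacian Q f x <= - (lam * \sum_x f x ^+ 2).

(** Gronwall's argument for the squared distance of [P t x] to the uniform
    distribution. *)
Lemma heat_kernel_L2 t x : 0 <= t ->
  \sum_z heat_kernel Q t x z ^+ 2 <= #|X|%:R^-1 + expR (- (2 * lam * t)).
Proof.
move=> t0.
have n0 : (#|X|%:R : R) != 0.
  by rewrite pnatr_eq0 -lt0n; apply/card_gt0P; exists x.
pose c : R := #|X|%:R^-1.
pose g s z := heat_kernel Q s z x - c.
have sum_g s : \sum_z g s z = 0.
  rewrite sumrB sumr_const -[c *+ _]mulr_natl divff //.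
  under eq_bigr do rewrite heat_kernel_sym //.
  by rewrite heat_kernel_sum // subrr.
have L2E s : \sum_z heat_kernel Q s x z ^+ 2 = c + \sum_z g s z ^+ 2.
  have -> : \sum_z g s z ^+ 2 = \sum_z (heat_kernel Q s x z ^+ 2
     - 2 * c * g s z - c * c).
    by apply: eq_bigr => z _; rewrite /g [heat_kernel Q s z x]heat_kernel_sym //; ring.
  rewrite !sumrB -mulr_sumr sum_g mulr0 subr0 sumr_const -mulr_natl mulrA divff //.
  by rewrite mul1r addrC subrK.
rewrite L2E lerD2l.
pose F s := - (expR (2 * lam * s) * \sum_z g s z ^+ 2).
have dg (s : R) z : is_derive s (1:R) (g ^~ z) (laplacian Q (g s) z).
  have -> : laplacian Q (g s) z = laplacian Q (fun y => heat_kernel Q s y x) z.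
    by apply: eq_bigr => y _; rewrite /g; ring.
  have := is_deriveB (is_derive_heat_kernel Q0 Q1 s z x) (is_derive_cst c s (1:R)).
  by rewrite subr0.
have : F 0 <= F t.
  apply: (@le_of_ge0_derive _ F (fun s =>
     - (2 * lam * expR (2 * lam * s) * (\sum_z g s z ^+ 2) +
        expR (2 * lam * s) * (2 * \sum_z g s z * laplacian Q (g s) z)))) => //.
    move=> s _; apply: is_deriveN; apply: is_derive_mul.
      have dl : is_derive s 1 (fun s : R => 2 * lam * s) (2 * lam).
        have := is_derive_mulC (2 * lam) (is_derive_id s (1:R)).
        rewrite mul1r (_ : (fun t => _) = (fun s : R => 2 * lam * s)) //.
        by apply/funext => r; rewrite mulrC.
      have := @is_derive_compf _ expR (fun s : R => 2 * lam * s) s _ _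
        (is_derive_expR _) dl.
      by move=> h; apply: is_derive_eq h _; rewrite mulrC.
    have := is_derive_sumf (fun z => is_derive_mul (dg s z) (dg s z)).
    move=> d; apply: is_derive_eq d _; rewrite mulr_sumr.
    by apply: eq_bigr => z _; ring.
  move=> s _; have := gap (sum_g s).
  move: (\sum_z g s z ^+ 2) (\sum_z g s z * laplacian Q (g s) z) => S W WS.
  have -> : - (2 * lam * expR (2 * lam * s) * S + expR (2 * lam * s) * (2 * W)) =
      expR (2 * lam * s) * (2 * (- (lam * S) - W)) by ring.
  by rewrite mulr_ge0 ?expR_ge0 // mulr_ge0 // subr_ge0.
rewrite /F lerN2 mulr0 expR0 mul1r => h.
have {}h : expR (2 * lam * t) * (\sum_z g t z ^+ 2) <= 1.
  apply: le_trans h _; rewrite (bigD1 x) //=.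
  have := L2E 0; rewrite (bigD1 x) //= big1 => [|z zx].
    rewrite heat_kernel_at0 eqxx expr1n addr0 => e.
    have -> : g 0 x ^+ 2 + \sum_(i | i != x) g 0 i ^+ 2 = 1 - c.
      by rewrite e [in RHS](bigD1 x) //=; ring.
    by rewrite lerBlDr lerDl invr_ge0.
  by rewrite heat_kernel_at0 eq_sym (negbTE zx) expr0n.
rewrite expRN -[leRHS]mul1r ler_pdivlMr ?expR_gt0 //.
by rewrite mulrC.
Qed.

End SpectralGap.

(** * The simple random walk on a regular graph *)

Section SimpleRandomWalk.
Variables (R : realType) (d : nat) (X : finType) (e : rel X).
Hypothesis hd : (2 <= d)%N.
Hypothesis he : connected_regular_graph e d.

Local Notation Q := (srw_kernel R e d).
Local Notation A := (adjacency_mx R e).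
Local Notation mu := (mu2 R e).

Let d0 : 0 < (d%:R : R). Proof. by rewrite ltr0n (leq_trans _ hd). Qed.

Lemma srw_kernelE x y : Q x y = (e x y)%:R / d%:R.
Proof. by rewrite /srw_kernel; case: (e x y); rewrite ?mul1r ?mul0r. Qed.

Lemma srw_sym x y : Q x y = Q y x.
Proof. by have [es _ _ _] := he; rewrite !srw_kernelE es. Qed.

Lemma srw_ge0 x y : 0 <= Q x y.
Proof. by rewrite srw_kernelE divr_ge0. Qed.

Lemma sum_edges x : \sum_y (e x y)%:R = d%:R :> R.
Proof.
have [_ _ _ dx] := he.
rewrite -natr_sum -(dx x) cardsE -sum1_card; congr (_%:R).
rewrite [RHS]big_mkcond /=; apply: eq_bigr => y _.
by rewrite unfold_in; case: (e x y).
Qed.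

Lemma srw_sum x : \sum_y Q x y = 1.
Proof.
under eq_bigr do rewrite srw_kernelE.
by rewrite -mulr_suml sum_edges divff // gt_eqF.
Qed.

Lemma srw_diag x : Q x x = 0.
Proof. by have [_ ei _ _] := he; rewrite srw_kernelE ei mul0r. Qed.

Lemma srw_ge_inv x y : 0 < Q x y -> d%:R^-1 <= Q x y.
Proof. by rewrite srw_kernelE; case: (e x y); rewrite ?mul1r ?mul0r ?ltxx. Qed.

Lemma srw_irreducible x z : exists k, 0 < transition Q k x z.
Proof.
have [_ _ /(_ x z)/connectP [p ep ->] _] := he; exists (size p).
elim: p x ep => [|y p IH] x /= => [_|/andP[exy py]]; first by rewrite eqxx.
apply: lt_le_trans (term_le_sum _ y).
  by rewrite mulr_gt0 ?IH // srw_kernelE exy mul1r invr_gt0.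
by move=> w; rewrite mulr_ge0 ?srw_ge0 // transition_ge0 //; exact: srw_ge0.
Qed.

Lemma sum_enum_val (F : X -> R) : \sum_(i < #|X|) F (enum_val i) = \sum_x F x.
Proof.
rewrite (reindex_onto (@enum_val X X) (@enum_rank X)) => [|x _].
  by apply: eq_bigl => i; rewrite /= enum_valK eqxx.
by rewrite enum_rankK.
Qed.

Lemma adjacency_sym : A^T = A.
Proof. by have [es _ _ _] := he; apply/matrixP => i j; rewrite !mxE es. Qed.

Let u : 'rV[R]_#|X| := const_mx 1.

Lemma ones_eigen : u *m A = d%:R *: u.
Proof.
have [es _ _ _] := he.
apply/rowP => j; rewrite !mxE mulr1 -(sum_edges (enum_val j)) -sum_enum_val.
by apply: eq_bigr => i _; rewrite !mxE mul1r es.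
Qed.

(** Evaluate the eigenvector equation where the eigenvector has its largest
    modulus. *)
Lemma adjacency_eigenvalue_le a : eigenvalue A a -> a <= d%:R.
Proof.
case/eigenvalueP => v vA v0.
have [i0 _] : exists i, v 0 i != 0.
  apply/existsP; apply: contraNT v0 => /existsPn h.
  by apply/eqP/rowP => i; rewrite [RHS]mxE; apply/eqP; move: (h i); rewrite negbK.
pose j := [arg max_(i > i0) `|v 0 i|]%O.
have jmax i : `|v 0 i| <= `|v 0 j|.
  by rewrite /j; case: arg_maxP => // k _ h; exact: h.
have vj : 0 < `|v 0 j|.
  rewrite normr_gt0; apply: contraNN v0 => /eqP vj0.
  apply/eqP/rowP => i; rewrite [RHS]mxE; apply/eqP; rewrite -normr_le0.
  by rewrite (le_trans (jmax i)) // vj0 normr0.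
rewrite (le_trans (ler_norm a)) // -(ler_pM2r vj) -normrM.
have -> : a * v 0 j = (v *m A) 0 j by rewrite vA mxE.
rewrite mxE -(sum_edges (enum_val j)) -sum_enum_val mulr_suml.
apply: le_trans (ler_norm_sum _ _ _) _; apply: ler_sum => i _.
have [es _ _ _] := he; rewrite mxE normrM normr_nat es mulrC.
by apply: ler_wpM2l; rewrite ?jmax.
Qed.

Lemma mu2_le : (1 < #|X|)%N -> mu <= d%:R.
Proof.
move=> n1; apply: second_eigenvalue_le => //; first exact: adjacency_sym.
exact: adjacency_eigenvalue_le.
Qed.

Lemma srw_poincare f : \sum_x f x = 0 ->
  \sum_x f x * laplacian Q f x <= - ((1 - mu / d%:R) * \sum_x f x ^+ 2).
Proof.
move=> f0; have [X0|/card_gt0P [x _]] := posnP #|X|.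
  have noX (y : X) : False by have := card0_eq X0 y; rewrite inE.
  by rewrite !big1 ?mulr0 ?oppr0 // => y; case: (noX y).
pose F : 'rV[R]_#|X| := \row_i f (enum_val i).
have u0 : u != 0.
  apply/eqP => /rowP /(_ (enum_rank x)); rewrite !mxE; exact/eqP/oner_neq0.
have Fu : F *m u^T = 0.
  apply/matrixP => i j; rewrite !mxE -[RHS]f0 -sum_enum_val.
  by apply: eq_bigr => k _; rewrite !mxE mulr1.
have := rayleigh_second_eigenvalue adjacency_sym ones_eigen u0
  adjacency_eigenvalue_le Fu.
have -> : (F *m F^T) 0 0 = \sum_x f x ^+ 2.
  by rewrite mxE -sum_enum_val; apply: eq_bigr => k _; rewrite !mxE.
have -> : (F *m A *m F^T) 0 0 = d%:R * \sum_x (f x * laplacian Q f x + f x ^+ 2).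
  rewrite -mulmxA mxE -sum_enum_val mulr_sumr; apply: eq_bigr => i _.
  rewrite [F 0 i]mxE mxE /laplacian.
  have -> : \sum_y (f y - f (enum_val i)) * Q (enum_val i) y =
     \sum_y (f y * Q (enum_val i) y) - f (enum_val i).
    rewrite -[X in _ - X]mulr1 -(srw_sum (enum_val i)) mulr_sumr -sumrB.
    by apply: eq_bigr => y _; ring.
  rewrite mulrBr expr2 subrK mulrCA; congr (_ * _).
  rewrite -sum_enum_val mulr_sumr; apply: eq_bigr => k _.
  rewrite !mxE srw_kernelE; field.
  by rewrite gt_eqF.
rewrite big_split /= -/mu => h.
set S := \sum_x f x ^+ 2 in h *; set L := \sum_x _ in h *.
rewrite -(ler_pM2l d0).
have -> : d%:R * - ((1 - mu / d%:R) * S) = mu * S - d%:R * S.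
  by field; rewrite gt_eqF.
by move: h; rewrite mulrDr => h; rewrite lerBrDr.
Qed.

Hypothesis CD : CDent_nonneg Q (@srw_measure R X).

(** The two bounds on the entropy at [T = ln n / (2 lam)] give
    [ln (n / 2) <= 8 d sqrt T], that is
    [ln (n / 2) ^ 2 * lam <= 32 d ^ 2 ln n], and [ln n <= 2 ln (n / 2)] absorbs
    one logarithm. *)
Lemma expansion_le : (4 * d <= #|X|)%N ->
  d%:R - mu <= 64 * d%:R ^+ 3 / ln (#|X|%:R / 4).
Proof.
move=> nd.
have n8 : (8 <= #|X|)%N by rewrite (leq_trans _ nd) // (leq_mul2l 4 2 d) hd.
set n : R := #|X|%:R.
have n8R : 8 <= n by rewrite ler_nat.
have n0 : 0 < n by lra.
have L4 : 0 < ln (n / 4) by apply: ln_gt0; lra.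
set lam := 1 - mu / d%:R.
have lamE : d%:R - mu = d%:R * lam.
  by rewrite /lam mulrBr mulr1 mulrCA divff ?mulr1 // gt_eqF.
have [lam0|lam0] := leP lam 0.
  apply: (@le_trans _ _ 0); first by rewrite lamE mulr_ge0_le0 // ltW.
  by rewrite divr_ge0 ?mulr_ge0 ?exprn_ge0 // ltW.
pose T := ln n / (2 * lam).
have lnn : 0 < ln n by apply: ln_gt0; lra.
have T0 : 0 < T by rewrite divr_gt0 // mulr_gt0.
have L2 x : \sum_z heat_kernel Q T x z ^+ 2 <= 2 / n.
  have := heat_kernel_L2 srw_sym srw_ge0 srw_sum srw_poincare x (ltW T0).
  rewrite -/lam (_ : 2 * lam * T = ln n); last first.
    by rewrite /T; field; rewrite gt_eqF.
  rewrite expRN lnK ?posrE // => h.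
  by apply: le_trans h _; rewrite -/n; lra.
have c0 : 0 < 2 / n by rewrite divr_gt0.
have di1 : (d%:R^-1 : R) <= 1 by rewrite invf_le1 // ler1n (leq_trans _ hd).
have d1 : 0 < (d%:R^-1 : R) by rewrite invr_gt0.
have lower := entropy_ge srw_ge0 srw_sum srw_irreducible T0 c0 L2.
have upper := entropy_le srw_sym srw_ge0 srw_sum srw_diag d1 srw_ge_inv
  srw_irreducible CD di1 (ltW T0).
have {lower upper} H : ln (n / 2) <= 8 * d%:R * Num.sqrt T.
  have := le_trans lower upper; rewrite -/n invrK.
  have -> : - ln (2 / n) = ln (n / 2) by rewrite -lnV ?posrE // invf_div.
  have -> : 8 * n * Num.sqrt T * d%:R = 8 * d%:R * Num.sqrt T * n by ring.
  by rewrite ler_pM2r.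
set L := ln (n / 2) in H.
have LL4 : ln (n / 4) <= L.
  by rewrite ler_ln ?posrE ?divr_gt0 // ler_pM2l // lef_pV2 ?posrE // ler_nat.
have L0 : 0 < L by apply: lt_le_trans LL4.
have lnL : ln n <= 2 * L.
  rewrite mulr_natl -lnXn ?divr_gt0 // ler_ln ?posrE ?exprn_gt0 ?divr_gt0 //.
  rewrite -subr_ge0 (_ : _ - _ = n * (n - 4) / 4); last by field.
  by rewrite divr_ge0 // mulr_ge0 ?ltW // subr_gt0; lra.
have H2 : L ^+ 2 <= 64 * d%:R ^+ 2 * T.
  have := ler_pM (ltW L0) (ltW L0) H H; rewrite -expr2 => h.
  apply: le_trans h _; rewrite -[X in _ <= _ * X](sqr_sqrtr (ltW T0)).
  by rewrite le_eqVlt; apply/orP; left; apply/eqP; ring.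
have H3 : L * lam <= 64 * d%:R ^+ 2.
  rewrite -(ler_pM2l L0).
  have := ler_wpM2r (ltW lam0) H2.
  have -> : L ^+ 2 * lam = L * (L * lam) by ring.
  have -> : 64 * d%:R ^+ 2 * T * lam = 32 * d%:R ^+ 2 * ln n.
    by rewrite /T; field; rewrite gt_eqF.
  move=> h; apply: le_trans h _.
  have c32 : 0 <= 32 * d%:R ^+ 2 :> R by rewrite mulr_ge0 ?exprn_ge0.
  by apply: le_trans (ler_wpM2l c32 lnL) _; lra.
rewrite lamE ler_pdivlMr // exprS mulrCA -mulrA ler_pM2l //.
by apply: le_trans H3; rewrite mulrC ler_pM2r.
Qed.

End SimpleRandomWalk.

(** * No expanders of non-negative entropic curvature *)

Lemma half_le_ln2 (R : realType) : 2^-1 <= ln (2 : R).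
Proof.
have : ln (1 + - 2^-1 : R) <= - 2^-1 by apply: le_ln1Dx; lra.
rewrite (_ : 1 + - 2^-1 = 2^-1 :> R); last by field.
by rewrite lnV ?posrE // lerN2.
Qed.

Lemma cvg_inv_ln_card (R : realType) (V : nat -> finType) (C : R) :
  (fun k => #|V k|) @ \oo --> \oo ->
  (fun k => C / ln (#|V k|%:R / 4)) @ \oo --> (0 : R).
Proof.
move=> cV; rewrite -(mulr0 C); apply: cvgMr.
apply/cvgrPdist_lt => eps eps0.
pose N := (Num.truncn (4 * expR (eps^-1 + 1) : R)).+1.
have hN : 4 * expR (eps^-1 + 1) < N%:R :> R by apply: truncnS_gt.
near=> k.
have kN : (N <= #|V k|)%N.
  by near: k; move/cvgnyPge : cV => /(_ N).
have h : eps^-1 + 1 < ln (#|V k|%:R / 4 : R).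
  rewrite -[ltLHS]expRK ltr_ln ?posrE ?expR_gt0 //.
    rewrite ltr_pdivlMr // mulrC (lt_le_trans hN) // ler_nat //.
  by rewrite divr_gt0 // ltr0n (leq_trans _ kN).
have e1 : 0 < eps^-1 by rewrite invr_gt0.
have l0 : 0 < ln (#|V k|%:R / 4 : R) by apply: lt_trans h; rewrite addr_gt0.
rewrite sub0r normrN gtr0_norm ?invr_gt0 // -[ltRHS]invrK ltf_pV2 ?posrE //.
by apply: lt_trans h; rewrite ltrDl.
Unshelve. all: by end_near. Qed.

Theorem theorem1p9 (R : realType) (d : nat) (hd : (2 <= d)%N) :
  (forall (X : finType) (e : rel X),
     connected_regular_graph e d ->
     (4 * d <= #|X|)%N ->
     CDent_nonneg (srw_kernel R e d) (@srw_measure R X) ->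
     d%:R - mu2 R e <= 4000 * d%:R ^+ 4 * ln d%:R / ln (#|X|%:R / 4))
  /\
  (forall (V : nat -> finType) (E : forall k, rel (V k)),
     (forall k, connected_regular_graph (E k) d) ->
     (forall k, CDent_nonneg (srw_kernel R (E k) d) (@srw_measure R (V k))) ->
     (fun k => #|V k|) @ \oo --> \oo ->
     (fun k => d%:R - mu2 R (E k)) @ \oo --> (0 : R)).
Proof.
have d2 : 2 <= d%:R :> R by rewrite ler_nat.
split.
  move=> X e he nX CD; apply: le_trans (expansion_le hd he CD nX) _.
  apply: ler_wpM2r.
    rewrite invr_ge0 ln_ge0 // ler_pdivlMr // mul1r ler_nat.
    by rewrite (leq_trans _ nX) // leq_pmulr // (leq_trans _ hd).
  have ld : 2^-1 <= ln (d%:R : R).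
    by apply: le_trans (half_le_ln2 R) _; rewrite ler_ln ?posrE //; lra.
  rewrite [d%:R ^+ 4]exprSr.
  have -> : 4000 * (d%:R ^+ 3 * d%:R) * ln d%:R =
      (d%:R ^+ 3 : R) * (4000 * (d%:R * ln d%:R)) by ring.
  rewrite mulrC; apply: ler_wpM2l; first by rewrite exprn_ge0.
  have : 2 * 2^-1 <= d%:R * ln (d%:R : R) by apply: ler_pM.
  by rewrite divff // => h; lra.
move=> V E hE CD cV.
apply: (@squeeze_cvgr _ _ _ _ (cst 0)
  (fun k => 64 * d%:R ^+ 3 / ln (#|V k|%:R / 4))); last 2 first.
- exact: cvg_cst.
- exact: cvg_inv_ln_card.
near=> k.
have nk : (4 * d <= #|V k|)%N.
  by near: k; move/cvgnyPge : cV => /(_ (4 * d)%N).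
rewrite (expansion_le hd (hE k) (CD k) nk) andbT subr_ge0 mu2_le //.
apply: leq_trans nk; rewrite (leq_trans hd) // leq_pmull //.
Unshelve. all: by end_near. Qed.
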